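(* There are absolute constants $c_1, c_2, c_3, c_4 > 0$ (independent of $p$, $q$, $n$, $L$) such that for all $p \in (1,\infty]$ and $q \in [1,\infty)$ with $1/p + 1/q = 1$ the following hold. $$\sqrt{n}\,(c_1L)^{-q/2} - 1 \leq \kappa_p(n,L) \leq \mu_q(n,L) \leq \sqrt{n}\,(c_2L)^{-q/2} + 2$$ for every $n \in \mathbb{N}$ and $L > 1/2$, and $$c_3 \min\left\{\sqrt{n(-\log L)},\, n\right\} \leq \kappa_p(n,L) \leq \mu_q(n,L) \leq c_4 \min\left\{\sqrt{n(-\log L)},\, n\right\} + 4$$ for every $n \in \mathbb{N}$ and $L \in (0,1/2]$. Moreover, $c_1 = 53$, $c_2 = 1/40$, $c_3 = 2/7$, and $c_4 = 13$ are appropriate choices.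
   Context: $\mathbb{N} = \{1,2,3,\ldots\}$, $\log$ is the natural logarithm, and $1/\infty = 0$. For $n \in \mathbb{N}$, $L > 0$ and $1 \leq p < \infty$, $\kappa_p(n,L)$ is the largest integer $k \geq 0$ for which there is a polynomial $P \neq 0$ of the form $$P(x) = \sum_{j=0}^n a_j x^j, \qquad |a_0| \geq L \left(\sum_{j=1}^n |a_j|^p\right)^{1/p}, \qquad a_j \in \mathbb{C},$$ such that $(x-1)^k$ divides $P(x)$. For $p = \infty$, $\kappa_\infty(n,L)$ is defined in the same way with the condition on the coefficients replaced by $|a_0| \geq L \max_{1 \leq j \leq n} |a_j|$. For $n \in \mathbb{N}$, $L > 0$ and $1 \leq q < \infty$, $\mu_q(n,L)$ is the smallest integer $k \geq 0$ for which there is a polynomial $Q$ of degree $k$ with complex coefficients such that $$|Q(0)| > \frac{1}{L} \left(\sum_{j=1}^n |Q(j)|^q\right)^{1/q}.$$ *)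

(* Defs.v *)
From mathcomp Require Import all_boot all_order all_algebra.
From mathcomp Require Import all_classical all_reals all_analysis.
From mathcomp Require Export complex.

Set Implicit Arguments.
Unset Strict Implicit.
Unset Printing Implicit Defensive.

Import Order.TTheory GRing.Theory Num.Theory.

Local Open Scope classical_set_scope.
Local Open Scope ring_scope.

(* The modulus of a complex number as an element of [R]; the generic norm
   [`|z|] on [R[i]] is itself valued in [R[i]]. *)
Notation cmod := ComplexField.Normc.normc.

(* The l^p norm of (f 1, ..., f n), for f taking nonnegative values. The value
   at -oo is junk; the theorem only uses 1 <= p. *)
Definition lpnorm (R : realType) (p : \bar R) (n : nat) (f : nat -> R) : R :=
  match p with
  | r%:E => (\sum_(1 <= j < n.+1) f j `^ r) `^ r^-1
  | +oo%E => \big[Num.max/0]_(1 <= j < n.+1) f j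
  | -oo%E => 0
  end.

Definition kappa_adm (R : realType) (p : \bar R) (n : nat) (L : R) (k : nat) :=
  exists P : {poly R[i]},
    [/\ P != 0,
        (size P <= n.+1)%N,
        cmod P`_0 >= L * lpnorm p n (fun j => cmod P`_j)
      & ('X - 1) ^+ k %| P].

Definition mu_adm (R : realType) (q : R) (n : nat) (L : R) (k : nat) :=
  exists Q : {poly R[i]},
    size Q = k.+1 /\
    cmod Q.[0] > 1 / L * lpnorm q%:E n (fun j => cmod Q.[j%:R]).

(* The default value 0 of [xget] is never used: see [kappaP] and [muP]. *)
Definition kappa (R : realType) (p : \bar R) (n : nat) (L : R) : nat :=
  xget 0%N [set k | kappa_adm p n L k /\
                    forall k', kappa_adm p n L k' -> (k' <= k)%N].

Definition mu (R : realType) (q : R) (n : nat) (L : R) : nat :=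
  xget 0%N [set k | mu_adm q n L k /\
                    forall k', mu_adm q n L k' -> (k <= k')%N].

Lemma lpnorm0 (R : realType) (p : \bar R) (n : nat) (f : nat -> R) :
  (0 < p)%E -> (forall j, (0 < j <= n)%N -> f j = 0) -> lpnorm p n f = 0.
Proof.
case: p => [r| |] //= r0 f0.
  have rN0 : r != 0 by rewrite gt_eqF // -lte_fin.
  rewrite big1_seq ?powR0 ?invr_eq0 // => j /andP[_].
  by rewrite mem_index_iota ltnS => /f0 ->; rewrite powR0.
rewrite big_seq; elim/big_ind: _ => // [x y -> ->|j]; first by rewrite maxxx.
by rewrite mem_index_iota ltnS => /f0.
Qed.

Lemma kappaP (R : realType) (p : \bar R) (n : nat) (L : R) : (0 < p)%E ->
  kappa_adm p n L (kappa p n L) /\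
  forall k, kappa_adm p n L k -> (k <= kappa p n L)%N.
Proof.
move=> p0; apply: (@xgetPex _ 0%N [set k | kappa_adm p n L k /\
  forall k', kappa_adm p n L k' -> (k' <= k)%N]).
have ex0 : exists k, `[< kappa_adm p n L k >].
  exists 0%N; apply/asboolP; exists 1; split.
  - exact: oner_neq0.
  - by rewrite size_poly1.
  - rewrite lpnorm0 // => [|j /andP[j0 _]].
      by rewrite mulr0; case: (_`_0) => a b; exact: sqrtr_ge0.
    by rewrite coef1 gtn_eqF // ComplexField.Normc.normc0.
  - by rewrite expr0 dvd1p.
have bnd k : `[< kappa_adm p n L k >] -> (k <= n)%N.
  move=> /asboolP[P [P0 sP _ dP]]; have := dvdp_leq P0 dP.
  by rewrite -['X - 1]/('X - 1%:P) size_exp_XsubC => /leq_trans/(_ sP).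
case: (ex_maxnP ex0 bnd) => k /asboolP kadm kmax.
by exists k; split=> // k' k'adm; apply/kmax/asboolP.
Qed.

Lemma muP (R : realType) (q : R) (n : nat) (L : R) : 0 < q ->
  mu_adm q n L (mu q n L) /\
  forall k, mu_adm q n L k -> (mu q n L <= k)%N.
Proof.
move=> q0; apply: (@xgetPex _ 0%N [set k | mu_adm q n L k /\
  forall k', mu_adm q n L k' -> (k <= k')%N]).
have exn : exists k, `[< mu_adm q n L k >].
  exists n; apply/asboolP.
  exists (\prod_(z <- [seq j%:R | j <- index_iota 1 n.+1]) ('X - z%:P)); split.
    by rewrite size_prod_XsubC size_map size_iota subn1.
  have rootE x : root (\prod_(z <- [seq j%:R | j <- index_iota 1 n.+1])
      ('X - z%:P)) x = (x \in [seq j%:R : R[i] | j <- index_iota 1 n.+1]).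
    exact: root_prod_XsubC.
  rewrite lpnorm0 // => [|j jn].
    rewrite mulr0 lt_neqAle; apply/andP; split; last first.
      by case: (_.[0]) => a b; exact: sqrtr_ge0.
    rewrite eq_sym; apply/eqP => /ComplexField.Normc.eq0_normc/eqP.
    rewrite -[_ == 0]/(root _ _) rootE => /mapP[j].
    rewrite mem_index_iota => /andP[j0 _] /esym/eqP.
    by rewrite pnatr_eq0 gtn_eqF.
  have /eqP -> : root (\prod_(z <- [seq j%:R | j <- index_iota 1 n.+1])
      ('X - z%:P)) (j%:R : R[i]).
    by rewrite rootE map_f // mem_index_iota ltnS.
  exact: ComplexField.Normc.normc0.
case: (ex_minnP exn) => k /asboolP kadm kmin.
by exists k; split=> // k' k'adm; apply/kmin/asboolP.
Qed.

(* Main.v *)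
Require Import Defs.
From mathcomp Require Import all_boot all_order all_algebra.
From mathcomp Require Import all_classical all_reals all_analysis.
From mathcomp Require Import qpoly ring lra zify.

Set Implicit Arguments.
Unset Strict Implicit.
Unset Printing Implicit Defensive.

Import Order.TTheory GRing.Theory Num.Theory.
Local Open Scope ring_scope.

(** The two quantities are linked by a duality.  If (X - 1)^k divides
    P = sum a_j X^j, then sum a_j Q(j) = 0 for every Q of degree < k
    ([moment_eq0]), so Hoelder bounds |a_0 Q(0)| by the l^p norm of the a_j times
    the l^q norm of the Q(j), 1 <= j <= n.  Hence no Q of degree < k can be
    admissible for mu when k is admissible for kappa ([kappa_le_mu]), and it
    remains to exhibit good polynomials on either side.

    Lower bounds for kappa.  Extrapolating from nodes x_1, ..., x_N to 0 writes
    R(0) = sum w_i R(x_i) for deg R < N, which says exactly that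
    1 - sum w_i X^(x_i) vanishes to order N at 1 ([dvdp_extrap_poly]).  For the
    nodes 1 and (s i)^2, 1 <= i <= k, the weights are summable uniformly in k:
    the squares alone would give weights at most 2, and the extra node 1 divides
    them by (s i)^2 - 1.  So degree (s k)^2 buys a zero of order k + 1 with
    constant coefficient 1 and total coefficient sum at most 2 + 2/(s - 1)
    ([flat_squares]).
    - For L > 1/2, averaging the dilates p(x^t), 1 <= t <= m, of such a
      polynomial keeps the constant coefficient and the total sum, but makes every
      other coefficient O(1/m) ([dilation_average]); interpolating between the sum
      and the maximum, the l^p norm is O(m^(-1/q)), and m ~ (3L)^q suffices.
    - For L <= 1/2, the r-th power of such a polynomial multiplies degree and
      order by r and raises the coefficient sum to the power r; the latter may be
      as large as 1/L, so r ~ -log L is allowed ([kappa_ge_squares]).  When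
      -log L > n the polynomial (1 - x)^n itself does the job.

    Upper bounds for mu.  The Fejer kernel gives a polynomial F of degree < m with
    F(0) = 1 and |F(x)| <= min(1, n/(m^2 x)) on [0, n] ([peaked_poly]).
    - Its square, with m^2 ~ n B, has sum of |F(j)|^2 over 1 <= j <= n at most
      4/B ([peaked_square]); B ~ L^(-q) settles L > 1/2, and B ~ 1/L settles
      -log L <= 2.
    - For 2 < -log L <= n take h ~ -log L and
      Q = prod_(i <= h) (1 - x/i) * F^(h+2) with m^2 ~ 25 n/h: the product
      removes the points j <= h, where F is not small, and beyond h the power of
      F beats the growth x^h/h! of the product by a factor e^(-2h)
      ([peaked_with_roots]).
    - For -log L > n the product prod_(i <= n) (1 - x/i) is enough. *)

(** * Discrete l^p norms *)

Section LpNorm.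
Variable R : realType.
Implicit Types (f g : nat -> R) (q : R) (p : \bar R).

Lemma cmod_ge0 (z : R[i]) : 0 <= cmod z.
Proof. by case: z => a b; exact: sqrtr_ge0. Qed.

Lemma cmod_real (x : R) : cmod (real_complex R x) = `|x|.
Proof. by rewrite /= expr0n /= addr0 sqrtr_sqr. Qed.

(** Splits conjugate exponents into the two situations that need different
    arguments: a maximum norm against a sum, and two genuine real exponents. *)
Lemma conjugate_cases p q : (1 < p)%E -> 1 <= q ->
  (p^-1 + (q%:E)^-1 = 1)%E ->
  (p = +oo%E /\ q = 1) \/
  (exists r : R, [/\ p = r%:E, 0 < r, 0 < q & r^-1 + q^-1 = 1]).
Proof.
move=> p1 q1; have q0 : 0 < q by exact: lt_le_trans q1.
case: p p1 => [r| |] //= r1.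
  rewrite lte_fin in r1; have r0 : 0 < r by exact: lt_trans r1.
  rewrite !inver !gt_eqF // -EFinD => -[rq]; right; exists r; split => //.
rewrite invey add0e => /eqP; rewrite inve_eq1 => /eqP[->]; by left.
Qed.

Lemma lpnorm_ge0 p n f : 0 <= lpnorm p n f.
Proof.
case: p => [r| |] //=; first exact: powR_ge0.
exact: bigmax_ge_id.
Qed.

Lemma lpnorm_pow r n f : 0 < r ->
  lpnorm r%:E n f `^ r = \sum_(1 <= j < n.+1) f j `^ r.
Proof.
move=> r0; rewrite /= -powRrM mulVf ?gt_eqF // powRr1 //.
by apply: sumr_ge0 => j _; exact: powR_ge0.
Qed.

Lemma le_lpnormy n f j : (0 < j <= n)%N -> f j <= lpnorm +oo%E n f.
Proof.
move=> jn; apply: le_bigmax_seq => //.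
by rewrite mem_index_iota.
Qed.

(** Young's inequality applied to the normalized entries; the degenerate cases
    of a zero norm are treated apart because of the normalization. *)
Lemma hoelder_sum p q n f g : (1 < p)%E -> 1 <= q ->
  (p^-1 + (q%:E)^-1 = 1)%E -> (forall j, 0 <= f j) -> (forall j, 0 <= g j) ->
  \sum_(1 <= j < n.+1) f j * g j <= lpnorm p n f * lpnorm q%:E n g.
Proof.
move=> p1 q1 pq f0 g0; have [[-> ->]|[r [-> r0 q0 rq]]] := conjugate_cases p1 q1 pq.
  rewrite [lpnorm 1%:E _ _]/= invr1 powRr1; last first.
    by apply: sumr_ge0 => j _; exact: powR_ge0.
  rewrite mulr_sumr !big_seq; apply: ler_sum => j.
  rewrite mem_index_iota => jn; rewrite powRr1 //.
  by apply: ler_wpM2r => //; exact: le_lpnormy.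
have lp0 (s : R) (h : nat -> R) : 0 < s -> (forall j, 0 <= h j) -> lpnorm s%:E n h = 0 ->
    forall j, j \in index_iota 1 n.+1 -> h j = 0.
  move=> s0 h0 hn0 j jn.
  have : \sum_(1 <= j < n.+1) h j `^ s = 0.
    by rewrite -(lpnorm_pow n h s0) hn0 powR0 ?gt_eqF.
  move/eqP; rewrite psumr_eq0 => [/allP/(_ j jn)/= /eqP/powR_eq0_eq0 //|i _].
  exact: powR_ge0.
move: (lp0 _ _ r0 f0) (lp0 _ _ q0 g0) (lpnorm_pow n f r0) (lpnorm_pow n g q0).
move: (lpnorm_ge0 r%:E n f) (lpnorm_ge0 q%:E n g).
move: (lpnorm r%:E n f) (lpnorm q%:E n g) => F G F_ge0 G_ge0 f_eq0 g_eq0 FE GE.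
have [F0|F0] := eqVneq F 0.
  by rewrite big1_seq ?F0 ?mul0r // => j /= jn; rewrite f_eq0 ?mul0r.
have [G0|G0] := eqVneq G 0.
  by rewrite big1_seq ?G0 ?mulr0 // => j /= jn; rewrite g_eq0 ?mulr0.
have Fp : 0 < F by rewrite lt_neqAle eq_sym F0.
have Gp : 0 < G by rewrite lt_neqAle eq_sym G0.
have sum_young (h : nat -> R) (s H : R) : 0 < s -> 0 < H -> (forall j, 0 <= h j) ->
    H `^ s = \sum_(1 <= j < n.+1) h j `^ s ->
    \sum_(1 <= j < n.+1) (h j / H) `^ s / s = s^-1.
  move=> s0 H0 h0 HE; under eq_bigr do rewrite powRM ?invr_ge0 ?(ltW H0) //.
  rewrite -!mulr_suml -HE -powRM ?invr_ge0 ?(ltW H0) //.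
  by rewrite divff ?gt_eqF // powR1 mul1r.
rewrite -[F * G]mulr1 -ler_pdivrMl ?mulr_gt0 // mulr_sumr -[X in _ <= X]rq.
rewrite -(sum_young _ _ _ r0 Fp f0 FE) -(sum_young _ _ _ q0 Gp g0 GE) -big_split.
apply: ler_sum => j _.
have fF : 0 <= f j / F by rewrite divr_ge0 // ltW.
have gG : 0 <= g j / G by rewrite divr_ge0 // ltW.
apply: le_trans (conjugate_powR fF gG r0 q0 rq).
by rewrite mulrC [leRHS]mulrACA -invfM.
Qed.

(** Hoelder tested against the indicator of [j]. *)
Lemma le_lpnorm p q n f j : (1 < p)%E -> 1 <= q ->
  (p^-1 + (q%:E)^-1 = 1)%E -> (forall j, 0 <= f j) -> (0 < j <= n)%N ->
  f j <= lpnorm p n f.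
Proof.
move=> p1 q1 pq f0 jn.
have := hoelder_sum n p1 q1 pq f0 (fun i => ler0n R (i == j)).
rewrite (bigD1_seq j) /= ?iota_uniq ?mem_index_iota // eqxx mulr1.
rewrite (bigD1_seq j) /= ?iota_uniq ?mem_index_iota // eqxx powR1.
rewrite big1 => [|i /negPf->]; last by rewrite mulr0.
rewrite big1 => [|i /negPf->]; last by rewrite powR0 // gt_eqF // (lt_le_trans _ q1).
by rewrite !addr0 powR1 mulr1.
Qed.

(** Since [f j ^ r <= M ^ (r - 1) * f j], a bound on the entries and a bound on
    their sum interpolate to any exponent.  The right-hand side is written with
    the conjugate exponent so that it also covers the maximum norm. *)
Lemma lpnorm_interpolate p q n f (M S : R) : (1 < p)%E -> 1 <= q ->
  (p^-1 + (q%:E)^-1 = 1)%E -> (forall j, 0 <= f j) ->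
  0 < S -> 0 <= M -> (forall j, (0 < j <= n)%N -> f j <= M) ->
  \sum_(1 <= j < n.+1) f j <= S ->
  lpnorm p n f <= M `^ q^-1 * S `^ (1 - q^-1).
Proof.
move=> p1 q1 pq f0 S0 M0 fM fS.
have [[-> ->]|[r [-> r0 q0 rq]]] := conjugate_cases p1 q1 pq.
  rewrite invr1 subrr powRr0 mulr1 powRr1 //= big_seq.
  elim/big_ind: _ => // [x y xM yM|j]; first by rewrite ge_max xM.
  by rewrite mem_index_iota => /fM.
have -> : 1 - q^-1 = r^-1 by rewrite -rq addrK.
have -> : q^-1 = (r - 1) * r^-1 by rewrite mulrBl mulfV ?gt_eqF // mul1r -rq addrC addKr.
rewrite powRrM -powRM ?powR_ge0 // ?(ltW S0) //=.
apply: ge0_ler_powR; rewrite ?nnegrE ?invr_ge0 ?(ltW r0) //.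
- by apply: sumr_ge0 => j _; exact: powR_ge0.
- by rewrite mulr_ge0 ?powR_ge0 // ltW.
have r1 : 0 <= r - 1.
  have q'0 : 0 < q^-1 by rewrite invr_gt0.
  have : r^-1 <= 1 by lra.
  by rewrite invf_le1 // => ?; lra.
apply: (@le_trans _ _ (\sum_(1 <= j < n.+1) M `^ (r - 1) * f j)); last first.
  by rewrite -mulr_sumr ler_wpM2l ?powR_ge0.
rewrite !big_seq; apply: ler_sum => j; rewrite mem_index_iota => /fM jM.
rewrite -mulr_powRB1 // mulrC; apply: ler_wpM2r => //.
by apply: ge0_ler_powR; rewrite ?nnegrE.
Qed.

Lemma lpnorm_le_sum p q n f : (1 < p)%E -> 1 <= q ->
  (p^-1 + (q%:E)^-1 = 1)%E -> (forall j, 0 <= f j) ->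
  lpnorm p n f <= \sum_(1 <= j < n.+1) f j.
Proof.
move=> p1 q1 pq f0; set S := \sum_(1 <= j < _) _.
have S0 : 0 <= S by apply: sumr_ge0.
have fS j : (0 < j <= n)%N -> f j <= S.
  move=> jn; rewrite /S (bigD1_seq j) /= ?iota_uniq ?mem_index_iota //.
  by rewrite lerDl sumr_ge0.
have [S00|SN0] := eqVneq S 0.
  rewrite lpnorm0 // => [|j /fS]; first by exact: lt_trans p1.
  by rewrite S00 => fj; apply/eqP; rewrite eq_le fj f0.
have Sp : 0 < S by rewrite lt_neqAle eq_sym SN0.
have := lpnorm_interpolate p1 q1 pq f0 Sp S0 fS (lexx _).
by rewrite -powRD ?SN0 ?implybT // addrC subrK powRr1.
Qed.

Lemma lqnorm_lt q n f (L : R) : 1 <= q -> 0 < L -> (forall j, 0 <= f j) ->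
  \sum_(1 <= j < n.+1) f j `^ q < L `^ q -> lpnorm q%:E n f < L.
Proof.
move=> q1 L0 f0 fL; have q0 : 0 < q by exact: lt_le_trans q1.
rewrite -(powRr1 (ltW L0)) -(@mulfV _ q) ?gt_eqF // powRrM /=.
apply: gt0_ltr_powR => //; rewrite ?nnegrE ?invr_gt0 ?powR_ge0 //.
by apply: sumr_ge0 => j _; exact: powR_ge0.
Qed.

End LpNorm.

(** * Moments, vanishing at 1, and the comparison of kappa and mu *)

Section Moments.
Variable K : numFieldType.
Implicit Types P Q : {poly K}.

(** The pairing of a coefficient sequence with the values of a polynomial at the
    integers; it expresses in a bilinear way the order of vanishing at 1. *)
Definition moment P Q : K := \sum_(j < size P) P`_j * Q.[j%:R].

Lemma moment_wide P Q n : (size P <= n)%N ->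
  moment P Q = \sum_(j < n) P`_j * Q.[j%:R].
Proof.
move=> sP; rewrite /moment (big_ord_widen n (fun j => P`_j * Q.[j%:R])) //.
rewrite big_mkcond; apply: eq_bigr => j _; case: ltnP => // /leq_sizeP/(_ j)->//.
by rewrite mul0r.
Qed.

(** The operator X d/dX multiplies the j-th coefficient by j, so it is the adjoint
    of multiplication by X on the other argument.  This is what makes the
    inductions below work. *)
Lemma momentMXaddC P Q c :
  moment P (Q * 'X + c%:P) = moment ('X * P^`()) Q + c * P.[1].
Proof.
have sP : (size ('X * P^`())%R <= size P)%N.
  have [->|P0] := eqVneq P 0; first by rewrite deriv0 mulr0.
  rewrite (leq_trans (size_polyMleq _ _)) // size_polyX /=.
  exact: lt_size_deriv.
rewrite (moment_wide _ sP) horner_coef mulr_sumr -big_split /=.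
apply: eq_bigr => j _; rewrite !hornerE expr1n /= mulr1 mulrDr [c * _]mulrC.
congr (_ + _); rewrite coefXM; case: j => -[|j] /= _; first by rewrite !(mulr0, mul0r).
by rewrite coef_deriv mulr_natr mulrnAr mulrnAl.
Qed.

(** X d/dX lowers the order of vanishing at 1 by at most one, while stripping a
    factor X lowers the degree of the test polynomial by one. *)
Lemma moment_eq0 k P Q : ('X - 1) ^+ k %| P -> (size Q <= k)%N -> moment P Q = 0.
Proof.
elim: k P Q => [|k IH] P Q dP sQ.
  move: sQ; rewrite size_poly_leq0 => /eqP->.
  by rewrite /moment big1 // => j _; rewrite horner0 mulr0.
elim/poly_ind: Q sQ => [|Q c _] sQ.
  by rewrite /moment big1 // => j _; rewrite horner0 mulr0.
have sQk : (size Q <= k)%N.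
  move: sQ; rewrite size_MXaddC; case: ifP => // /andP[/eqP-> _] _.
  by rewrite size_poly0.
case/dvdpP: dP => S ->; rewrite momentMXaddC IH //.
  by rewrite exprS !hornerM !hornerE /= subrr !(mul0r, mulr0, add0r).
rewrite derivM deriv_exp derivB derivX -[1]/(1%:P : {poly K}) derivC subr0 polyC1 mul1r.
apply: dvdp_mull; apply: dvdp_add.
  by rewrite exprS mulrA dvdp_mulIr.
by rewrite mulrnAr -mulrnAl; exact: dvdp_mulIr.
Qed.

(** In characteristic 0, the order of a zero of P is one more than its order as a zero
    of P'.  The order is raised one step at a time: if P = (X - 1)^m S, the
    divisibility of P' forces X - 1 to divide m S. *)
Lemma root_dvdp_deriv k P : P.[1] = 0 -> ('X - 1) ^+ k %| P^`() ->
  ('X - 1) ^+ k.+1 %| P.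
Proof.
move=> P1 dP'; suff H m : (m <= k.+1)%N -> ('X - 1) ^+ m %| P by exact: H.
have X1 : 'X - 1 != 0 :> {poly K} by rewrite -[1]polyC1 polyXsubC_eq0.
elim: m => [|m IH] mk; first by rewrite expr0 dvd1p.
case: m => [|m] in IH mk *.
  by rewrite expr1 -polyC1 dvdp_XsubCl; apply/rootP.
have /dvdpP[S PS] := IH (ltnW mk).
have : ('X - 1) ^+ m.+1 %| P^`().
  by apply: dvdp_trans dP'; apply: dvdp_exp2l.
rewrite PS derivM deriv_exp derivB derivX -[1 in X in _ %| X]polyC1 derivC subr0 polyC1 mul1r.
rewrite dvdp_addr; last exact: dvdp_mulIr.
rewrite /= exprS mulrnAr -mulrnAl dvdp_mul2r ?expf_neq0 // -scaler_nat.
rewrite dvdpZr ?pnatr_eq0 // => dS.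
by rewrite -exprS [X in X %| _]exprS dvdp_mul2r // expf_neq0.
Qed.

(** The moments of P of positive degree are those of X P', so X P' falls under the
    induction hypothesis; X is coprime to X - 1 and can be dropped. *)
Lemma dvdp_of_moments k P :
  (forall Q, (size Q <= k)%N -> moment P Q = 0) -> ('X - 1) ^+ k %| P.
Proof.
elim: k P => [|k IH] P mP; first by rewrite expr0 dvd1p.
have P1 : P.[1] = 0.
  have := momentMXaddC P 0 1; rewrite mul0r add0r mP ?size_poly1 // mul1r.
  by rewrite /moment big1 ?add0r // => j _; rewrite horner0 mulr0.
apply: root_dvdp_deriv => //.
have : ('X - 1) ^+ k %| 'X * P^`().
  apply: IH => Q sQ; have := momentMXaddC P Q 0; rewrite mul0r !addr0 => <-.
  apply: mP; rewrite (leq_trans (size_polyMleq _ _)) //.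
  by rewrite size_polyX addnC /= addn1 ltnS.
rewrite Gauss_dvdpr // coprimep_expl // coprimepX.
by rewrite -[1]polyC1 root_XsubC eq_sym oner_eq0.
Qed.

Lemma momentB P P' Q : moment (P - P') Q = moment P Q - moment P' Q.
Proof.
have s := size_polyD P (- P'); rewrite size_polyN in s.
rewrite (moment_wide _ (leq_maxl (size P) (size P'))).
rewrite (moment_wide _ (leq_maxr (size P) (size P'))) (moment_wide _ s).
by rewrite -sumrB; apply: eq_bigr => j _; rewrite coefB mulrBl.
Qed.

Lemma momentZXn c m Q : moment (c *: 'X^m) Q = c * Q.[m%:R].
Proof.
rewrite (@moment_wide _ _ m.+1); last first.
  by rewrite (leq_trans (size_scale_leq _ _)) // size_polyXn.
rewrite (bigD1 (Ordinal (ltnSn m))) //= coefZ coefXn eqxx mulr1 big1 ?addr0 //.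
by move=> j /negPf jm; rewrite coefZ coefXn -val_eqE /= in jm *; rewrite jm mulr0 mul0r.
Qed.

Lemma moment1 Q : moment 1 Q = Q.[0].
Proof. by have := momentZXn 1 0 Q; rewrite scale1r expr0 mul1r. Qed.

Lemma moment0 Q : moment 0 Q = 0.
Proof. by rewrite /moment size_poly0 big_ord0. Qed.

Lemma moment_sum I (s : seq I) (F : I -> {poly K}) Q :
  moment (\sum_(i <- s) F i) Q = \sum_(i <- s) moment (F i) Q.
Proof.
elim: s => [|i s IH]; first by rewrite !big_nil moment0.
rewrite !big_cons -IH -[in LHS](opprK (\sum_(j <- s) F j)) momentB.
by rewrite -[- (\sum_(j <- s) F j)]sub0r momentB moment0 sub0r opprK.
Qed.

End Moments.

Section Duality.
Variable R : realType.

(** If mu < kappa, an optimal Q for mu is annihilated by the coefficients of an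
    optimal P for kappa; Hoelder then contradicts the strict inequality defining
    mu, unless the constant coefficient and hence all of P vanish. *)
Lemma kappa_le_mu p q n (L : R) : (1 < p)%E -> 1 <= q ->
  (p^-1 + (q%:E)^-1 = 1)%E -> 0 < L -> (kappa p n L <= mu q n L)%N.
Proof.
move=> p1 q1 pq L0.
have [[P [P0 sP aP dP]] _] := kappaP n L (lt_trans lte01 p1).
have [[Q [sQ bQ]] _] := muP n L (lt_le_trans ltr01 q1).
rewrite leqNgt; apply/negP => lt_mk.
have := moment_eq0 dP (_ : size Q <= _)%N; rewrite sQ => /(_ lt_mk).
rewrite (moment_wide Q sP) big_ord_recl /= => /eqP; rewrite addr_eq0 => /eqP E.
have cD (s : seq nat) (F : nat -> R[i]) :
    cmod (\sum_(j <- s) F j) <= \sum_(j <- s) cmod (F j).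
  elim: s => [|x s IH]; first by rewrite !big_nil ComplexField.Normc.normc0.
  by rewrite !big_cons (le_trans (le_normcD _ _)) // lerD2l.
set A := lpnorm p n (fun j => cmod P`_j) in aP.
set B := lpnorm q%:E n (fun j => cmod Q.[j%:R]) in bQ.
have key : cmod P`_0 * cmod Q.[0] <= A * B.
  rewrite -ComplexField.Normc.normcM [X in cmod X]E normcN.
  rewrite -(big_mkord predT (fun j => P`_j.+1 * Q.[j.+1%:R])).
  apply: le_trans (cD _ _) _.
  under eq_bigr do rewrite ComplexField.Normc.normcM.
  have := @hoelder_sum R p q n (fun j => cmod P`_j) (fun j => cmod Q.[j%:R]) p1 q1 pq.
  by rewrite big_add1 /=; apply => j; exact: cmod_ge0.
have A0 : 0 <= A by exact: lpnorm_ge0.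
have B0 : 0 <= B by exact: lpnorm_ge0.
have a0 : cmod P`_0 = 0.
  have : 0 <= cmod P`_0 by exact: cmod_ge0.
  rewrite le_eqVlt => /orP[/eqP//|a0].
  have : cmod P`_0 * (1 / L * B) < A * B.
    by apply: lt_le_trans key; rewrite ltr_pM2l.
  rewrite mulrCA -ltr_pdivlMl ?divr_gt0 // !div1r invrK => H.
  have : L * (A * B) <= cmod P`_0 * B by rewrite mulrA ler_wpM2r.
  by rewrite leNgt H.
have A00 : A = 0.
  by apply/eqP; rewrite eq_le A0 andbT -(pmulr_rle0 _ L0) -a0.
case/negP: P0; apply/eqP/polyP => j; rewrite coef0.
have [jn|nj] := ltnP n j; first by rewrite nth_default // (leq_trans sP).
case: j nj => [_|j jn]; first exact: ComplexField.Normc.eq0_normc.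
apply: ComplexField.Normc.eq0_normc; apply/eqP; rewrite eq_le cmod_ge0 andbT.
by rewrite -A00; apply: (le_lpnorm p1 q1 pq (fun j => cmod_ge0 P`_j)).
Qed.

End Duality.

(** * Coefficient sums and extrapolation polynomials *)

Section CoefficientSum.
Variable K : numFieldType.
Implicit Types P Q : {poly K}.

Definition l1norm P : K := \sum_(j < size P) `|P`_j|.

Lemma l1norm_wide P n : (size P <= n)%N -> l1norm P = \sum_(j < n) `|P`_j|.
Proof.
move=> sP; rewrite /l1norm (big_ord_widen n (fun j => `|P`_j|)) //.
rewrite big_mkcond; apply: eq_bigr => j _; case: ltnP => // /leq_sizeP/(_ j)->//.
by rewrite normr0.
Qed.

Lemma l1norm_ge0 P : 0 <= l1norm P.
Proof. exact: sumr_ge0. Qed.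

Lemma l1normD P Q : l1norm (P + Q) <= l1norm P + l1norm Q.
Proof.
rewrite (l1norm_wide (leq_maxl (size P) (size Q))).
rewrite (l1norm_wide (leq_maxr (size P) (size Q))) (l1norm_wide (size_polyD P Q)).
by rewrite -big_split; apply: ler_sum => j _; rewrite coefD ler_normD.
Qed.

Lemma l1norm_sum I (s : seq I) (F : I -> {poly K}) :
  l1norm (\sum_(i <- s) F i) <= \sum_(i <- s) l1norm (F i).
Proof.
elim: s => [|i s IH]; first by rewrite !big_nil /l1norm size_poly0 big_ord0.
by rewrite !big_cons (le_trans (l1normD _ _)) // lerD2l.
Qed.

Lemma l1normZ c P : l1norm (c *: P) = `|c| * l1norm P.
Proof.
rewrite (l1norm_wide (size_scale_leq c P)) mulr_sumr.
by apply: eq_bigr => j _; rewrite coefZ normrM.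
Qed.

Lemma l1normN P : l1norm (- P) = l1norm P.
Proof. by rewrite -scaleN1r l1normZ normrN1 mul1r. Qed.

Lemma l1normXM P : l1norm ('X * P) = l1norm P.
Proof.
rewrite (@l1norm_wide _ (size P).+1); last first.
  by rewrite (leq_trans (size_polyMleq _ _)) // size_polyX.
rewrite big_ord_recl coefXM normr0 add0r.
by apply: eq_bigr => j _; rewrite coefXM.
Qed.

Lemma l1normXnM m P : l1norm ('X^m * P) = l1norm P.
Proof.
elim: m => [|m IH]; first by rewrite expr0 mul1r.
by rewrite exprS -mulrA l1normXM.
Qed.

Lemma l1norm1 : l1norm 1 = 1.
Proof. by rewrite (@l1norm_wide _ 1) ?size_poly1 // big_ord1 coef1 normr1. Qed.

Lemma l1normXn m : l1norm 'X^m = 1.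
Proof. by rewrite -['X^m]mulr1 l1normXnM l1norm1. Qed.

Lemma l1normM P Q : l1norm (P * Q) <= l1norm P * l1norm Q.
Proof.
rewrite -[P in P * Q]coefK poly_def mulr_suml (le_trans (l1norm_sum _ _)) //.
rewrite mulr_suml; apply: ler_sum => j _.
by rewrite -scalerAl l1normZ l1normXnM.
Qed.

End CoefficientSum.

Section Extrapolation.
Variables (K : numFieldType) (x : nat -> nat) (N : nat).

(** The value at 0 of the i-th Lagrange basis polynomial for the nodes
    [x 0, ..., x (N - 1)]. *)
Definition extrap_weight (i : nat) : K :=
  \prod_(j < N | j != i :> nat) ((x j)%:R / ((x j)%:R - (x i)%:R)).

Definition extrap_poly : {poly K} := 1 - \sum_(i < N) extrap_weight i *: 'X^(x i).

Hypothesis x_inj : injective x.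

(** Lagrange interpolation at the nodes is exact in degree < N, so its value at 0
    is the moment identity required by [dvdp_of_moments]. *)
Lemma dvdp_extrap_poly : ('X - 1) ^+ N %| extrap_poly.
Proof.
apply: dvdp_of_moments => Q sQ.
case: (posnP N) => [N0|N_gt0].
  move: sQ; rewrite {1}N0 size_poly_leq0 => /eqP->.
  by rewrite /moment big1 // => j _; rewrite horner0 mulr0.
have xK_inj : injective (fun i => (x i)%:R : K).
  by move=> i j /eqP; rewrite eqr_nat => /eqP/x_inj.
rewrite momentB moment1 moment_sum.
under eq_bigr do rewrite momentZXn.
rewrite [Q in Q.[0]](lagrange_gen N_gt0 xK_inj sQ) horner_sum.
apply/eqP; rewrite subr_eq0; apply/eqP; apply: eq_bigr => i _.
rewrite hornerM hornerC mulrC; congr (_ * _).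
rewrite (lagrangeE N_gt0 xK_inj) /= hornerM hornerC !horner_prod -prodfV -big_split /=.
apply: eq_bigr => j ji; rewrite !hornerXsubC sub0r mulrN -mulNr -invrN opprB mulrC.
by [].
Qed.

Lemma extrap_poly1 : (0 < N)%N -> \sum_(i < N) extrap_weight i = 1.
Proof.
move=> N_gt0; have : root extrap_poly 1.
  rewrite -dvdp_XsubCl polyC1; apply: dvdp_trans dvdp_extrap_poly.
  by rewrite -{1}['X - 1]expr1 dvdp_exp2l.
rewrite /root /extrap_poly hornerD hornerN hornerC horner_sum subr_eq0 => /eqP->.
by apply: eq_bigr => i _; rewrite hornerZ hornerXn expr1n mulr1.
Qed.

End Extrapolation.

(** * Extrapolation weights for square nodes *)

Section SquareNodes.
Variable K : realFieldType.

Lemma fact_split_le k a : (a <= k)%N -> (k`! * k`! <= (k - a)`! * (k + a)`!)%N.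
Proof.
elim: a => [|a IH] ak; first by rewrite subn0 addn0.
apply: leq_trans (IH (ltnW ak)) _.
rewrite -(subnSK ak) addnS !factS mulnCA -mulnA leq_mul2r; apply/orP; right; lia.
Qed.

Lemma prod_shift_fact m i : ((\prod_(j < i) (m + j.+1)) * m`! = (m + i)`!)%N.
Proof.
elim: i => [|i IH]; first by rewrite big_ord0 mul1n addn0.
by rewrite big_ord_recr /= mulnAC IH addnS factS mulnC.
Qed.

Lemma prod_sub_fact i : (\prod_(j < i) (i - j) = i`!)%N.
Proof.
rewrite (reindex_inj rev_ord_inj) -[i`!](prod_shift_fact 0) muln1.
by apply: eq_bigr => j _; rewrite /= subKn.
Qed.

(** The absolute value of the product of [x_j / (x_j - x_i)] over the square nodes
    alone, where the scale [s] cancels. *)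
Definition square_ratio i k : K := \prod_(j < k | j != i :> nat)
  ((j.+1 ^ 2)%:R / `|(j.+1 ^ 2)%:R - (i.+1 ^ 2)%:R|).

Lemma sqr_diffE a b : (a < b)%N ->
  `|(b ^ 2)%:R - (a ^ 2)%:R| = ((b - a) * (b + a))%:R :> K.
Proof.
move=> ab; have ab2 : (a ^ 2 <= b ^ 2)%N by rewrite leq_exp2r // ltnW.
by rewrite -(natrB _ ab2) normr_nat subn_sqr.
Qed.

(** The factors [j^2 - i^2 = (j - i) (j + i)] telescope into factorials. *)
Lemma square_ratioE i k : (i < k)%N ->
  square_ratio i k * ((k - i.+1)`! * (k + i.+1)`!)%:R = 2 * (k`! * k`!)%:R.
Proof.
elim: k => // k IH; rewrite ltnS leq_eqVlt => /orP[/eqP ik|ik].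
  rewrite -{k IH}ik subnn mul1n.
  have -> : square_ratio i i.+1 =
      \prod_(j < i) ((j.+1 ^ 2)%:R / ((i - j) * (i.+1 + j.+1))%:R).
    rewrite /square_ratio big_mkcond big_ord_recr /= eqxx mulr1.
    apply: eq_bigr => j _; rewrite ltn_eqF // distrC sqr_diffE ?ltnS //.
  rewrite prodf_div -!natr_prod.
  have -> : (\prod_(j < i) j.+1 ^ 2 = i`! ^ 2)%N.
    by rewrite -(prod_shift_fact 0) muln1; elim/big_rec2: _ => // j y1 y2 _ ->; rewrite expnMn.
  rewrite big_split /= prod_sub_fact.
  have F := prod_shift_fact i.+1 i.
  have F0 : (0 < \prod_(j < i) (i.+1 + j.+1))%N by apply: prodn_gt0 => j; lia.
  rewrite mulrAC -natrM -natrM; apply: (canLR (mulfK _)).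
    by rewrite pnatr_eq0 muln_eq0 negb_or -!lt0n fact_gt0.
  rewrite -!natrM; congr _%:R; rewrite addnS factS -F (factS i).
  move: (\prod_(j < i) _) i`! => a c.
  rewrite -[(i.+1 + i).+1]addn1 -[i.+1]addn1; ring.
rewrite /square_ratio big_mkcond big_ord_recr -big_mkcond /= -/(square_ratio i k).
rewrite gtn_eqF // sqr_diffE ?ltnS // subSS addSn [(_ + _).+1`!]factS.
have -> : ((k - i)`! = (k - i) * (k - i.+1)`!)%N by rewrite -{1}(subnSK ik) factS subnSK.
have := IH ik; rewrite factS; set Q := square_ratio i k; rewrite !natrM => E.
have h1 : (k - i)%:R != 0 :> K by rewrite pnatr_eq0; lia.
have h2 : (k + i.+1).+1%:R != 0 :> K by rewrite pnatr_eq0.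
transitivity (Q * ((k - i.+1)`!%:R * (k + i.+1)`!%:R) * (k.+1 ^ 2)%:R).
  rewrite /= natrX; move: h1 h2.
  by move: ((k - i)%:R) ((k + i.+1).+1%:R) => u v u0 v0; field; rewrite ?u0 ?v0.
by rewrite E natrX; ring.
Qed.

Lemma square_ratio_le2 i k : (i < k)%N -> square_ratio i k <= 2.
Proof.
move=> ik; have F0 : 0 < ((k - i.+1)`! * (k + i.+1)`!)%:R :> K.
  by rewrite ltr0n muln_gt0 !fact_gt0.
rewrite -(ler_pM2r F0) square_ratioE // ler_pM2l // ler_nat.
exact: fact_split_le.
Qed.

Variable s : nat.
Hypothesis s_gt1 : (1 < s)%N.

(** The node 1 next to the squares of the positive multiples of [s] is what makes the
    weights summable: it contributes the factor [1 / ((s i)^2 - 1)]. *)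
Definition square_node i : nat := if i is i'.+1 then ((s * i'.+1) ^ 2)%N else 1%N.

Lemma square_node_inj : injective square_node.
Proof.
have ne1 i : ((s * i.+1) ^ 2 <> 1)%N.
  move/eqP; rewrite -[X in _ == X](exp1n 2) eqn_exp2r // muln_eq1.
  by move/andP=> [/eqP s1]; move: s_gt1; rewrite s1.
case=> [|i] [|j] //= => [/esym/ne1|/ne1|] // /eqP.
rewrite eqn_exp2r // eqn_pmul2l; last exact: ltnW.
by move/eqP.
Qed.

Lemma square_weight_le k (i : 'I_k) :
  `|extrap_weight K square_node k.+1 i.+1| <= 2 / ((s * i.+1) ^ 2 - 1)%N%:R.
Proof.
have s2 : 1 < ((s * i.+1) ^ 2)%:R :> K.
  by rewrite ltr1n -[X in (X < _)%N](exp1n 2) ltn_exp2r // (leq_trans s_gt1) // leq_pmulr.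
have s0 : s%:R != 0 :> K by rewrite pnatr_eq0 -lt0n ltnW.
rewrite /extrap_weight big_mkcond big_ord_recl /= normrM.
rewrite div1r normfV distrC [`|_ - 1|]ger0_norm ?subr_ge0 ?(ltW s2) //= mulrC.
have s1 : (1 < (s * i.+1) ^ 2)%N by rewrite -(ltr_nat K).
rewrite natrB ?(ltnW s1) // ler_pM2r ?invr_gt0 ?subr_gt0 //.
apply: le_trans (square_ratio_le2 (ltn_ord i)).
rewrite le_eqVlt; apply/orP; left; apply/eqP.
rewrite normr_prod /square_ratio [RHS]big_mkcond; apply: eq_bigr => j _.
rewrite /bump leq0n add1n add0n eqSS; case: ifP => _; last by rewrite normr1.
rewrite !expnMn !natrM -mulrBr -mulf_div divff ?mulf_neq0 // mul1r.
by rewrite normrM normfV normrM normr_nat.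
Qed.

(** For [s = 2] the terms are [1/(2i-1) - 1/(2i+1)] and telescope; for larger [s]
    they are smaller at least by the factor [s - 1]. *)
Lemma sum_square_weight_le k :
  \sum_(i < k) (2 / ((s * i.+1) ^ 2 - 1)%N%:R) <= (s.-1%:R)^-1 :> K.
Proof.
have s1 : 0 < s.-1%:R :> K by rewrite ltr0n; lia.
pose u i : K := - ((2 * i).+1%:R)^-1.
apply: (@le_trans _ _ (\sum_(i < k) (s.-1%:R)^-1 * (u i.+1 - u i))).
  apply: ler_sum => i _; have -> : u i.+1 - u i = 2 / ((2 * i).+1 * (2 * i.+1).+1)%:R.
    have h1 : (2 * i).+1%:R != 0 :> K by rewrite pnatr_eq0.
    have h2 : (2 * i.+1).+1%:R != 0 :> K by rewrite pnatr_eq0.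
    have h12 : (2 * i.+1).+1%:R = (2 * i).+1%:R + 2 :> K.
      by rewrite -natrD; congr _%:R; lia.
    rewrite /u opprK natrM; move: h1 h2 h12.
    move: (_.+1%:R) (_.+1%:R) => a b a0 b0 E; move: b0; rewrite {}E => b0.
    by field; rewrite ?a0 ?b0.
  have key : (s.-1 * ((2 * i).+1 * (2 * i.+1).+1) <= (s * i.+1) ^ 2 - 1)%N.
    have [r ->] : exists r, s = r.+2 by exists s.-2; lia.
    nia.
  rewrite mulrCA ler_pM2l ?ltr0n // -invfM -natrM lef_pV2 ?posrE ?ltr0n ?ler_nat //.
    by rewrite (leq_trans _ key) // muln_gt0; lia.
  by rewrite muln_gt0; lia.
rewrite -mulr_sumr ger_pMr ?invr_gt0 //.
rewrite -(big_mkord predT (fun i => u i.+1 - u i)) telescope_sumr // /u muln0 invr1 opprK.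
by rewrite addrC gerBl invr_ge0.
Qed.

End SquareNodes.

(** * Polynomials with a dominant constant coefficient *)

Section FlatPolynomials.
Variable R : realType.
Implicit Types (P : {poly R}) (S : R).

(** The constant coefficient is normalized to 1, so that [S - 1] bounds the sum of the
    other ones and the class is stable under products. *)
Definition flat (k d : nat) S := exists P,
  [/\ P`_0 = 1, (size P <= d.+1)%N, l1norm P <= S & ('X - 1) ^+ k %| P].

Lemma flatM k d S k' d' S' :
  flat k d S -> flat k' d' S' -> flat (k + k') (d + d') (S * S').
Proof.
move=> [P [P0 sP lP dP]] [Q [Q0 sQ lQ dQ]]; exists (P * Q); split.
- by rewrite coef0M P0 Q0 mulr1.
- by rewrite (leq_trans (size_polyMleq _ _)) //; lia.
- by rewrite (le_trans (l1normM P Q)) // ler_pM ?l1norm_ge0.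
- by rewrite exprD dvdp_mul.
Qed.

Lemma flatX r k d S : flat k d S -> flat (r * k) (r * d) (S ^+ r).
Proof.
move=> fS; elim: r => [|r IH].
  exists 1; split; rewrite ?coef1 ?size_poly1 ?l1norm1 ?mul0n ?expr0 //.
by rewrite exprS !mulSn; exact: flatM.
Qed.

Lemma flat_binomial n : flat n n (2 ^+ n).
Proof.
suff: flat 1 1 2 by move/(flatX n); rewrite !muln1.
exists (1 - 'X); split.
- by rewrite coefB coef1 coefX subr0.
- rewrite (leq_trans (size_polyD _ _)) // size_polyN size_poly1 size_polyX.
  by [].
- by rewrite (le_trans (l1normD _ _)) // l1normN l1norm1 -['X]expr1 l1normXn.
- by rewrite expr1 -[1 - 'X]opprB -[- ('X - 1)]scaleN1r dvdpZr ?oppr_eq0 ?oner_eq0.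
Qed.

(** Each weight at a square is controlled by [square_weight_le]; the weight at the
    node 1 then follows, since all the weights sum to 1. *)
Lemma flat_squares s k : (1 < s)%N ->
  flat k.+1 (maxn 1 ((s * k) ^ 2)) (2 + 2 / s.-1%:R).
Proof.
move=> s1; exists (extrap_poly R (square_node s) k.+1).
have inj := square_node_inj s1; split.
- rewrite /extrap_poly coefB coef1 eqxx coef_sum big1 ?subr0 // => i _.
  rewrite coefZ coefXn eq_sym eqn0Ngt; case: i => -[|i] /= _; first by rewrite mulr0.
  by rewrite expn_gt0 muln_gt0 (ltnW s1) mulr0.
- rewrite /extrap_poly (leq_trans (size_polyD _ _)) // geq_max size_poly1 /= size_polyN.
  apply: (leq_trans (size_sum _ _ _)); apply/bigmax_leqP => i _.
  rewrite (leq_trans (size_scale_leq _ _)) // size_polyXn ltnS.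
  case: i => -[|i] /= ik; first exact: leq_maxl.
  by rewrite leq_max leq_exp2r // leq_mul2l; apply/orP; right; apply/orP; right.
- set W := \sum_(i < k) `|extrap_weight R (square_node s) k.+1 i.+1|.
  have W0 : `|extrap_weight R (square_node s) k.+1 0| <= 1 + W.
    have := extrap_poly1 R inj (ltn0Sn k).
    rewrite big_ord_recl /= => /(canRL (addrK _)) ->.
    rewrite (le_trans (ler_normB _ _)) // normr1 lerD2l.
    exact: ler_norm_sum.
  have Ws : W <= s.-1%:R^-1.
    apply: le_trans (sum_square_weight_le R s1 k).
    by apply: ler_sum => i _; exact: square_weight_le.
  rewrite (le_trans (l1normD _ _)) // l1normN l1norm1.
  have := l1norm_sum (index_enum 'I_k.+1)
    (fun i => extrap_weight R (square_node s) k.+1 i *: 'X^(square_node s i)).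
  under [X in _ <= X -> _]eq_bigr do rewrite l1normZ l1normXn mulr1.
  rewrite [X in _ <= X -> _]big_ord_recl /=.
  by move: W0 Ws; rewrite -/W; move: (l1norm _) => l; lra.
- exact: dvdp_extrap_poly.
Qed.

Lemma kappa_ge p n (L : R) k P : (1 < p)%E -> 0 < L ->
  P`_0 = 1 -> (size P <= n.+1)%N -> L * lpnorm p n (fun j => `|P`_j|) <= 1 ->
  ('X - 1) ^+ k %| P -> (k <= kappa p n L)%N.
Proof.
move=> p1 L0 P0 sP bP dP; apply: (kappaP n L (lt_trans lte01 p1)).2.
exists (map_poly (real_complex R) P); split.
- by rewrite map_poly_eq0; apply: contra_eq_neq P0 => ->; rewrite coef0 eq_sym oner_eq0.
- by rewrite size_map_poly.
- rewrite coef_map cmod_real P0 normr1.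
  have -> // : (fun j => cmod (map_poly (real_complex R) P)`_j) = (fun j => `|P`_j|).
  by apply: funext => j; rewrite coef_map cmod_real.
- have -> : 'X - 1 = map_poly (real_complex R) ('X - 1).
    by rewrite rmorphB /= map_polyX rmorph1.
  by rewrite -rmorphXn /= dvdp_map.
Qed.

Lemma sum_coef_tail P n : P`_0 = 1 -> (size P <= n.+1)%N ->
  \sum_(1 <= j < n.+1) `|P`_j| = l1norm P - 1.
Proof.
move=> P0 sP; rewrite (l1norm_wide sP) big_ord_recl P0 normr1 addrC addKr.
by rewrite big_add1 big_mkord.
Qed.

(** Every l^p norm is at most the l^1 norm, which leaves the sum [S] minus the
    constant coefficient. *)
Lemma kappa_ge_flat p q n (L : R) k d S : (1 < p)%E -> 1 <= q ->
  (p^-1 + (q%:E)^-1 = 1)%E -> 0 < L ->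
  flat k d S -> (d <= n)%N -> S - 1 <= L^-1 -> (k <= kappa p n L)%N.
Proof.
move=> p1 q1 pq L0 [P [P0 sP lP dP]] dn SL.
have sPn : (size P <= n.+1)%N by exact: leq_trans sP _.
apply: (kappa_ge p1 L0 P0 sPn _ dP).
rewrite -ler_pdivlMl // mulr1 (le_trans _ SL) //.
rewrite (le_trans (lpnorm_le_sum _ p1 q1 pq _)) //.
by rewrite sum_coef_tail // lerD2r.
Qed.

(** The coefficient of X^j in the average collects p_(j/t)/m over the t dividing j.
    The quotients j/t are distinct, so it is at most 1/m times the sum of
    all non-constant coefficients of p. *)
Lemma dilation_average k d S m : (0 < m)%N -> flat k d S -> exists P,
  [/\ P`_0 = 1, (size P <= (m * d).+1)%N, l1norm P <= S,
      (forall j, (0 < j)%N -> `|P`_j| <= (S - 1) / m%:R) &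
      ('X - 1) ^+ k %| P].
Proof.
move=> m0 [p [p0 sp lp dp]].
have mK0 : m%:R != 0 :> R by rewrite pnatr_eq0 -lt0n.
exists (m%:R^-1 *: \sum_(t < m) (p \Po 'X^(t.+1))); split.
- rewrite coefZ coef_sum (eq_bigr (fun=> 1)); last first.
    by move=> t _; rewrite coef_comp_poly_Xn // dvdn0 div0n.
  by rewrite sumr_const card_ord mulVf.
- rewrite (leq_trans (size_scale_leq _ _)) //.
  apply: (leq_trans (size_sum _ _ _)); apply/bigmax_leqP => t _.
  rewrite (leq_trans (size_comp_poly_leq _ _)) // size_polyXn ltnS /=.
  by rewrite mulnC leq_mul //; move: sp; case: (size p).
- rewrite l1normZ ger0_norm ?invr_ge0 // ler_pdivrMl ?ltr0n //.
  rewrite (le_trans (l1norm_sum _ _)) //.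
  have -> : m%:R * S = \sum_(t < m) S by rewrite sumr_const card_ord mulr_natl.
  apply: ler_sum => t _; apply: le_trans lp.
  rewrite comp_polyE (le_trans (l1norm_sum _ _)) //.
  by apply: ler_sum => i _; rewrite l1normZ -exprM l1normXn mulr1.
- move=> j j0; rewrite coefZ normrM ger0_norm ?invr_ge0 // mulrC.
  rewrite ler_pM2r ?invr_gt0 ?ltr0n // coef_sum (le_trans (ler_norm_sum _ _ _)) //.
  apply: (@le_trans _ _ (\sum_(1 <= i < d.+1) `|p`_i|)); last first.
    by rewrite sum_coef_tail // lerD2r.
  (* Count pairs (t, i) with i t = j: at most one t for each i. *)
  apply: (@le_trans _ _ (\sum_(t < m) \sum_(1 <= i < d.+1)
      if (i * t.+1 == j)%N then `|p`_i| else 0)).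
    apply: ler_sum => t _; rewrite coef_comp_poly_Xn //.
    have s0 (F : nat -> R) (A : pred nat) : (forall i, 0 <= F i) ->
        0 <= \sum_(1 <= i < d.+1 | A i) F i by move=> F0; apply: sumr_ge0.
    have if0 i : 0 <= (if (i * t.+1 == j)%N then `|p`_i| else 0) by case: ifP.
    case: ifP => [tj|_]; last by rewrite normr0 s0.
    have [big|small] := ltnP d (j %/ t.+1).
      by rewrite nth_default ?normr0 ?s0 // (leq_trans sp).
    rewrite (bigD1_seq (j %/ t.+1)%N) ?iota_uniq ?mem_index_iota ?small ?andbT //=.
      by rewrite divnK // eqxx lerDl s0.
    by rewrite divn_gt0 // ltnS small dvdn_leq.
  rewrite exchange_big /=; apply: ler_sum_nat => i /andP[i0 _].
  case: (pickP (fun t : 'I_m => (i * t.+1 == j)%N)) => [t /eqP tj|no].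
    rewrite (bigD1 t) //= tj eqxx big1 ?addr0 // => t' /negPf t't.
    case: eqP => // t'j; move: t't; rewrite -val_eqE /=.
    have /eqP := etrans t'j (esym tj); rewrite eqn_pmul2l // eqSS.
    by move=> /eqP->; rewrite eqxx.
  by rewrite big1 // => t _; rewrite no.
- rewrite dvdpZr ?invr_neq0 //; elim/big_ind: _ => [|A B|t _].
  + exact: dvdp0.
  + exact: dvdp_add.
  + have /dvdpP[T ->] := dp; rewrite comp_polyM dvdp_mull //.
    rewrite rmorphXn rmorphB rmorph1 /= comp_polyX dvdp_exp2r //.
    by rewrite subrX1 dvdp_mulIl.
Qed.

End FlatPolynomials.

(** * Lower bounds for kappa *)

Section KappaLowerLarge.
Variable R : realType.

Lemma sqrt_powRN (n : nat) (a q : R) : 0 < a ->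
  Num.sqrt n%:R * a `^ (- (q / 2)) = Num.sqrt (n%:R / a `^ q).
Proof.
move=> a0; rewrite powRN powRrM powR12_sqrt ?powR_ge0 //.
by rewrite sqrtrM // sqrtrV // powR_ge0.
Qed.

(** With X = (3L)^q, m just above X and k ~ sqrt(n / 4m), the average of m dilates of
    the polynomial for the nodes 1 and (2i)^2 has l^p norm at most 1/L outside
    its constant term.  The constant 53 absorbs the rounding of m, as
    4m <= 4X + 4 <= (53/3) X <= (53L)^q. *)
Lemma kappa_lower_large (p : \bar R) (q L : R) (n : nat) :
  (1 < p)%E -> 1 <= q -> (p^-1 + (q%:E)^-1 = 1)%E -> 1 / 2 < L ->
  Num.sqrt n%:R * (53 * L) `^ (- (q / 2)) - 1 <= (kappa p n L)%:R.
Proof.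
move=> + q1 + L2; have L0 : 0 < L by lra.
have q0 : 0 < q by lra.
have LL : 0 < 53 * L by lra.
rewrite sqrt_powRN //; set Z := (53 * L) `^ q.
pose X := (3 * L) `^ q.
have X0 : 0 < X by apply: powR_gt0; lra.
have X1 : 3 / 2 <= X by apply: le_trans (le1r_powR _ q1); lra.
have XZ : 53 / 3 * X <= Z.
  have -> : Z = (53 / 3) `^ q * X.
    by rewrite /Z /X -powRM; [congr (_ `^ _); field| |lra]; lra.
  by rewrite ler_pM2r //; apply: le1r_powR => //; lra.
pose m := (Num.truncn X).+1.
have /andP[mX Xm] := truncn_itv (ltW X0); rewrite -/m in Xm.
have mX1 : m%:R <= X + 1 by rewrite /m -natr1 lerD2r.
have m0 : 0 < m%:R :> R by rewrite ltr0n.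
pose y : R := Num.sqrt (n%:R / (4 * m%:R)).
have y0 : 0 <= y by exact: sqrtr_ge0.
have Zy : Num.sqrt (n%:R / Z) <= y.
  rewrite ler_wsqrtr // ler_wpM2l // lef_pV2 ?posrE; lra.
have /andP[ky yk] := truncn_itv y0.
set k := Num.truncn y in ky yk.
move=> p1 pq; suff : (k <= kappa p n L)%N by rewrite -(ler_nat R) -natr1 in yk *; lra.
case: (posnP k) => [-> //|k0].
have dn : (m * maxn 1 ((2 * k) ^ 2) <= n)%N.
  have -> : (maxn 1 ((2 * k) ^ 2) = 4 * k ^ 2)%N.
    by rewrite expnMn; apply/maxn_idPr; rewrite muln_gt0 !expn_gt0 k0.
  rewrite -(ler_nat R) !natrM.
  have : k%:R ^+ 2 <= n%:R / (4 * m%:R) :> R.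
    have <- : y ^+ 2 = n%:R / (4 * m%:R) by rewrite sqr_sqrtr // divr_ge0 // mulr_ge0.
    by rewrite ler_sqr ?nnegrE.
  rewrite ler_pdivlMr ?mulr_gt0 //; clear -m; lra.
have [P [P0 sP lP cP dP]] := dilation_average (ltn0Sn _ : 0 < m)%N (@flat_squares R 2 k isT).
apply: ltnW; apply: (kappa_ge p1 L0 P0 _ _ dP); first by rewrite (leq_trans sP).
rewrite /= invr1 mulr1 in lP cP.
(* Bounding the coefficients by 3 a ^ q instead of 3 / m makes the interpolated norm
   exactly 3 a = 1 / L. *)
pose a := (3 * L)^-1.
have a0 : 0 < a by rewrite invr_gt0 mulr_gt0.
have aX : a `^ q = X^-1.
  apply: (mulIf (lt0r_neq0 X0)); rewrite mulVf ?gt_eqF // -powRM ?(ltW a0) //.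
    by rewrite mulVf ?powR1 // gt_eqF // mulr_gt0.
  by rewrite ltW // mulr_gt0.
have am : m%:R^-1 <= a `^ q by rewrite aX lef_pV2 ?posrE // ltW.
have sPn : (size P <= n.+1)%N by rewrite (leq_trans sP).
have tail : \sum_(1 <= j < n.+1) `|P`_j| <= 3.
  by rewrite sum_coef_tail //; clear -lP; lra.
have cP' j : (0 < j <= n)%N -> `|P`_j| <= 3 * a `^ q.
  move=> /andP[/cP cj _]; apply: (le_trans cj).
  have -> : 2 + 2 - 1 = 3 :> R by ring.
  by rewrite ler_pM2l.
have := lpnorm_interpolate p1 q1 pq (fun j => normr_ge0 P`_j) (ltr0n R 3) _ cP' tail.
move=> /(_ _)/wrap[]; first by rewrite mulr_ge0 ?powR_ge0.
have -> : (3 * a `^ q) `^ q^-1 * 3 `^ (1 - q^-1) = L^-1.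
  rewrite powRM ?powR_ge0 // -powRrM mulfV ?gt_eqF // powRr1 ?(ltW a0) //.
  rewrite mulrAC -powRD; last by rewrite pnatr_eq0 implybT.
  by rewrite addrC subrK powRr1 // /a invfM mulrA mulfV ?mul1r.
by move=> ?; rewrite -ler_pdivlMl // mulr1.
Qed.

End KappaLowerLarge.

Section KappaLowerSmall.
Variable R : realType.

Lemma pow_le_expR m (x : R) : 0 <= 1 + x -> (1 + x) ^+ m <= expR (m%:R * x).
Proof.
by move=> x0; rewrite expRM_natl lerXn2r ?nnegrE ?expR_ge0 ?expR_ge1Dx.
Qed.

(** The r-th power of the polynomial with k ~ sqrt(n/r)/s has order r (k + 1),
    which exceeds r sqrt(n/r)/s: rounding k down costs nothing. *)
Lemma kappa_ge_squares (p : \bar R) (q L : R) (n s r : nat) :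
  (1 < p)%E -> 1 <= q -> (p^-1 + (q%:E)^-1 = 1)%E -> 0 < L ->
  (1 < s)%N -> (0 < r <= n)%N -> (2 + 2 / s.-1%:R) ^+ r - 1 <= L^-1 ->
  Num.sqrt (n%:R * r%:R) / s%:R <= (kappa p n L)%:R :> R.
Proof.
move=> p1 q1 pq L0 s1 /andP[r0 rn] SL.
have rR : 0 < r%:R :> R by rewrite ltr0n.
have sR : 0 < s%:R :> R by rewrite ltr0n ltnW.
pose y : R := Num.sqrt (n%:R / r%:R) / s%:R.
have y0 : 0 <= y by rewrite divr_ge0 ?sqrtr_ge0.
have /andP[ky yk] := truncn_itv y0; set k := Num.truncn y in ky yk.
have sk : (r * (s * k) ^ 2 <= n)%N.
  rewrite -(ler_nat R) natrM mulrC -ler_pdivlMr // natrX.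
  rewrite -[leRHS]sqr_sqrtr ?divr_ge0 // ler_sqr ?nnegrE ?sqrtr_ge0 //.
  by rewrite natrM mulrC -ler_pdivlMr.
have dn : (r * maxn 1 ((s * k) ^ 2) <= n)%N by rewrite maxnMr muln1 geq_max rn sk.
have := kappa_ge_flat p1 q1 pq L0 (flatX r (@flat_squares R s k s1)) dn SL.
rewrite -(ler_nat R); apply: le_trans.
have -> : Num.sqrt (n%:R * r%:R) / s%:R = r%:R * y.
  have -> : n%:R * r%:R = r%:R ^+ 2 * (n%:R / r%:R) :> R by field; rewrite gt_eqF.
  by rewrite sqrtrM ?sqr_ge0 // sqrtr_sqr ger0_norm // /y mulrA.
by rewrite natrM ler_pM2l // ltW.
Qed.

(** With l = - ln L <= n, the sparser scale s = 3 is used as long as expR l < 3, because its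
    coefficient sum 3 fits for every L <= 1/2; beyond that s = 2, whose sum is
    4 <= expR (3/2), is used with r ~ 2l/3. *)
Lemma kappa_lower_small (p : \bar R) (q L : R) (n : nat) :
  (1 < p)%E -> 1 <= q -> (p^-1 + (q%:E)^-1 = 1)%E -> (0 < n)%N ->
  0 < L -> L <= 1 / 2 ->
  2 / 7 * Num.min (Num.sqrt (n%:R * - ln L)) n%:R <= (kappa p n L)%:R.
Proof.
move=> p1 q1 pq n0 L0 L2; set l := - ln L.
have nR : 0 < n%:R :> R by rewrite ltr0n.
have le : expR l = L^-1 by rewrite /l -lnV ?posrE // lnK ?posrE ?invr_gt0.
have l2 : 2 <= expR l by rewrite le -[2]invrK lef_pV2 ?posrE // -div1r.
have l0 : 0 < l by rewrite -expR_gt1 (lt_le_trans _ l2) // ltr1n.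
have [nl|ln] := ltP n%:R l.
  apply: (@le_trans _ _ n%:R).
    rewrite (@le_trans _ _ (1 * Num.min (Num.sqrt (n%:R * l)) n%:R)) //.
      by rewrite ler_wpM2r ?le_min ?sqrtr_ge0 ?ltW //; clear; lra.
    by rewrite mul1r ge_min lexx orbT.
  rewrite ler_nat; apply: (kappa_ge_flat p1 q1 pq L0 (flat_binomial R n)) => //.
  rewrite lerBlDr (le_trans _ (_ : L^-1 <= _)) ?lerDl // -le.
  apply: (@le_trans _ _ (expR n%:R)); last by rewrite ler_expR ltW.
  by have := @pow_le_expR n 1; rewrite mulr1 => ->.
apply: (@le_trans _ _ (2 / 7 * Num.sqrt (n%:R * l))).
  by rewrite ler_wpM2l ?ge_min ?lexx.
have sqrt_scale (a : R) : 0 <= a -> 4 / 49 * l <= a ^+ 2 ->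
    2 / 7 * Num.sqrt (n%:R * l) <= Num.sqrt n%:R * a.
  move=> a0 la; rewrite sqrtrM // mulrCA ler_wpM2l ?sqrtr_ge0 //.
  rewrite -[leRHS]ger0_norm // -sqrtr_sqr.
  have -> : 2 / 7 * Num.sqrt l = Num.sqrt ((2 / 7) ^+ 2 * l).
    by rewrite sqrtrM ?sqr_ge0 // sqrtr_sqr ger0_norm.
  apply: ler_wsqrtr; apply: le_trans la; rewrite le_eqVlt; apply/orP; left; apply/eqP.
  by field.
have squares s r s1 rn := @kappa_ge_squares p q L n s r p1 q1 pq L0 s1 rn.
clear p1 q1 pq; have [l3|l3] := ltP (expR l) 3.
  (* 13/10 < 49/36, the largest l for which sqrt n / 3 still suffices. *)
  have l13 : l < 13 / 10.
    rewrite ltNge; apply/negP; rewrite -ler_expR => l13.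
    have : (1 + 13 / 100) ^+ 10 <= expR (10%:R * (13 / 100)) :> R by apply: pow_le_expR; lra.
    have -> : 10%:R * (13 / 100) = 13 / 10 :> R by field.
    lra.
  have bd : (2 + 2 / 2%:R) ^+ 1 - 1 <= L^-1 by rewrite -le expr1; lra.
  apply: le_trans (squares 3%N 1%N isT _ bd); last by rewrite n0.
  by rewrite mulr1; apply: sqrt_scale; lra.
(* r = max 1 (truncn y) satisfies 4 ^ r <= 1 + expR l and r >= l / 3; the latter is
   enough since (2/7)^2 l <= r/4 as soon as r >= (16/49) l. *)
pose y := 2 / 3 * l; have y0 : 0 <= y by rewrite /y; lra.
have /andP[ty yt] := truncn_itv y0; set t := Num.truncn y in ty yt.
rewrite -natr1 in yt.
have [t0|t0] := posnP t.
  have bd : (2 + 2 / 1%:R) ^+ 1 - 1 <= L^-1 by rewrite -le expr1; lra.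
  apply: le_trans (squares 2%N 1%N isT _ bd); last by rewrite n0.
  rewrite mulr1; apply: sqrt_scale; first by lra.
  by move: yt; rewrite t0 /y; lra.
have tn : (0 < t <= n)%N by rewrite t0 -(ler_nat R); rewrite /y in ty; lra.
have bd : (2 + 2 / 1%:R) ^+ t - 1 <= L^-1.
  have E4 : 4 <= expR (3 / 2) :> R.
    have : (1 + 15 / 100) ^+ 10 <= expR (10%:R * (15 / 100)) :> R by apply: pow_le_expR; lra.
    have -> : 10%:R * (15 / 100) = 3 / 2 :> R by field.
    lra.
  rewrite -le divr1 -natrD; apply: (@le_trans _ _ (4 ^+ t)); first by rewrite gerBl.
  apply: (@le_trans _ _ (expR (3 / 2) ^+ t)); first by rewrite lerXn2r ?nnegrE ?expR_ge0.
  by rewrite -expRM_natl ler_expR; rewrite /y in ty; lra.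
apply: le_trans (squares 2%N t isT tn bd).
rewrite [X in _ <= X / _]sqrtrM // -[leRHS]mulrA; apply: sqrt_scale.
  by rewrite divr_ge0 ?sqrtr_ge0.
have t1 : 1 <= t%:R :> R by rewrite ler1n.
have -> : (Num.sqrt t%:R / 2%:R) ^+ 2 = t%:R / 4 :> R.
  by rewrite expr_div_n sqr_sqrtr // -natrX.
move: yt t1; rewrite /y; clear; lra.
Qed.

End KappaLowerSmall.

(** * The Fejer kernel *)

Section FejerKernel.
Variable R : realType.

Fixpoint chebyshev (m : nat) : {poly R} :=
  match m with
  | 0 => 1
  | 1 => 'X
  | (m2.+1 as m1).+1 => 'X * chebyshev m1 *+ 2 - chebyshev m2
  end.

Lemma chebyshevSS m :
  chebyshev m.+2 = 'X * chebyshev m.+1 *+ 2 - chebyshev m.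
Proof. by []. Qed.

Lemma size_chebyshev m : (size (chebyshev m) <= m.+1)%N.
Proof.
suff [] : (size (chebyshev m) <= m.+1)%N /\ (size (chebyshev m.+1) <= m.+2)%N by [].
elim: m => [|m [IH1 IH2]]; first by rewrite size_poly1 size_polyX.
split=> //; rewrite chebyshevSS (leq_trans (size_polyD _ _)) // geq_max size_polyN.
rewrite (leq_trans IH1) ?andbT; last by lia.
rewrite -scaler_nat (leq_trans (size_scale_leq _ _)) // (leq_trans (size_polyMleq _ _)) //.
by rewrite size_polyX.
Qed.

Lemma chebyshev_cos m (x : R) : (chebyshev m).[cos x] = cos (m%:R * x).
Proof.
suff [] : (chebyshev m).[cos x] = cos (m%:R * x) /\
  (chebyshev m.+1).[cos x] = cos (m.+1%:R * x) by [].
elim: m => [|m [IH1 IH2]].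
  by rewrite /= hornerX hornerC mul0r cos0 mul1r.
split=> //; rewrite chebyshevSS hornerD hornerN hornerMn hornerM hornerX IH1 IH2.
have -> : m%:R * x = m.+1%:R * x - x by rewrite -natr1; ring.
have -> : m.+2%:R * x = m.+1%:R * x + x by rewrite -natr1; ring.
by rewrite cosB cosD; ring.
Qed.

Lemma chebyshev1 m : (chebyshev m).[1] = 1.
Proof. by rewrite -cos0 chebyshev_cos mulr0. Qed.

Lemma chebyshev_le1 m y : -1 <= y <= 1 -> `|(chebyshev m).[y]| <= 1.
Proof. by move=> y1; rewrite -(acosK y1) chebyshev_cos cos_max. Qed.

(** At [cos t] this is the Dirichlet kernel, the sum of [cos (j t)] over
    [-m <= j <= m]. *)
Definition dirichlet m : {poly R} := 1 + (\sum_(j < m) chebyshev j.+1) *+ 2.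

(** At [cos t], up to normalization, this is the Fejer kernel
    [(1 - cos (m t)) / (1 - cos t)]. *)
Definition fejer m : {poly R} := \sum_(i < m) dirichlet i.

Lemma dirichletS m : dirichlet m.+1 = dirichlet m + chebyshev m.+1 *+ 2.
Proof. by rewrite /dirichlet big_ord_recr /= mulrnDl addrA. Qed.

Lemma dirichletE m : (1 - 'X) * dirichlet m = chebyshev m - chebyshev m.+1.
Proof.
elim: m => [|m IH]; first by rewrite /dirichlet big_ord0 mul0rn addr0 mulr1.
by rewrite dirichletS mulrDr IH chebyshevSS; ring.
Qed.

Lemma fejerS m : fejer m.+1 = fejer m + dirichlet m.
Proof. exact: big_ord_recr. Qed.

Lemma fejerE m : (1 - 'X) * fejer m = 1 - chebyshev m.
Proof.
elim: m => [|m IH]; first by rewrite /fejer big_ord0 mulr0 subrr.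
by rewrite fejerS mulrDr IH dirichletE addrA subrK.
Qed.

Lemma size_dirichlet m : (size (dirichlet m) <= m.+1)%N.
Proof.
elim: m => [|m IH]; first by rewrite /dirichlet big_ord0 mul0rn addr0 size_poly1.
rewrite dirichletS (leq_trans (size_polyD _ _)) // geq_max (leq_trans IH) // andTb.
by rewrite -scaler_nat (leq_trans (size_scale_leq _ _)) // size_chebyshev.
Qed.

Lemma size_fejer m : (size (fejer m) <= m)%N.
Proof.
apply: (leq_trans (size_sum _ _ _)); apply/bigmax_leqP => i _.
exact: leq_trans (size_dirichlet i) (ltn_ord i).
Qed.

Lemma sum_odd m : \sum_(i < m) (i.*2.+1%:R) = m%:R ^+ 2 :> R.
Proof.
elim: m => [|m IH]; first by rewrite big_ord0 expr0n.
by rewrite big_ord_recr /= IH -natrX -natrD -natrX; congr _%:R; nia.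
Qed.

Lemma fejer1 m : (fejer m).[1] = m%:R ^+ 2.
Proof.
rewrite -sum_odd horner_sum; apply: eq_bigr => i _.
rewrite hornerD hornerC hornerMn horner_sum (eq_bigr (fun=> 1)) => [|j _].
  by rewrite sumr_const card_ord -mulrnA muln2 -[RHS]natr1 addrC.
exact: chebyshev1.
Qed.

Lemma fejer_le m y : -1 <= y <= 1 -> `|(fejer m).[y]| <= m%:R ^+ 2.
Proof.
move=> y1; rewrite -sum_odd horner_sum (le_trans (ler_norm_sum _ _ _)) //.
apply: ler_sum => i _; rewrite hornerD hornerC hornerMn horner_sum.
rewrite (le_trans (ler_normD _ _)) // normr1 -natr1 addrC lerD2r normrMn -muln2 mulrnA.
rewrite ler_pMn2r // (le_trans (ler_norm_sum _ _ _)) //.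
rewrite -[X in _ <= X%:R]card_ord -sumr_const; apply: ler_sum => j _.
exact: chebyshev_le1.
Qed.

(** The Fejer kernel transported to [0, n] by [y = 1 - 2x/n] and normalized by its
    value m^2 at y = 1; the decay comes from [(1 - y) fejer m = 1 - chebyshev m]. *)
Lemma peaked_poly m n : (0 < m)%N -> (0 < n)%N -> exists F : {poly R},
  [/\ F.[0] = 1, (size F <= m)%N &
      forall x, 0 <= x <= n%:R ->
        `|F.[x]| <= 1 /\ m%:R ^+ 2 * x * `|F.[x]| <= n%:R].
Proof.
move=> m0 n0.
have mR : 0 < m%:R ^+ 2 :> R by rewrite exprn_gt0 // ltr0n.
have nR : 0 < n%:R :> R by rewrite ltr0n.
pose g : {poly R} := 1 - (2 / n%:R) *: 'X.
have gE x : g.[x] = 1 - 2 / n%:R * x by rewrite !hornerE.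
exists ((m%:R ^+ 2)^-1 *: (fejer m \Po g)); split.
- by rewrite hornerZ horner_comp gE mulr0 subr0 fejer1 mulVf // gt_eqF.
- rewrite (leq_trans (size_scale_leq _ _)) // (leq_trans (size_comp_poly_leq _ _)) //.
  have sg : (size g <= 2)%N.
    rewrite (leq_trans (size_polyD _ _)) // geq_max size_poly1 /= size_polyN.
    by rewrite (leq_trans (size_scale_leq _ _)) // size_polyX.
  by move: (size_fejer m) sg; case: (size (fejer m)) => [|a]; case: (size g) => [|b] /=; nia.
- move=> x /andP[x0 xn].
  have y1 : -1 <= g.[x] <= 1.
    have xn1 : x / n%:R <= 1 by rewrite ler_pdivrMr // mul1r.
    have xn0 : 0 <= x / n%:R by rewrite divr_ge0.
    by rewrite gE -mulrA [_^-1 * x]mulrC; apply/andP; split; lra.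
  rewrite hornerZ horner_comp normrM [`|_^-1|]ger0_norm ?invr_ge0 ?(ltW mR) //; split.
    by rewrite ler_pdivrMl // mulr1 fejer_le.
  rewrite mulrACA mulfV ?gt_eqF // mul1r.
  have : 1 - g.[x] = 2 / n%:R * x by rewrite gE; ring.
  move: y1; move: g.[x] => u u1 xu.
  have := congr1 (fun p => `|p.[u]|) (fejerE m).
  rewrite hornerM normrM !hornerD !hornerN hornerX !hornerC xu => E.
  have : `|2 / n%:R * x| * `|(fejer m).[u]| <= 2.
    rewrite E (le_trans (ler_normB _ _)) // normr1.
    by have := chebyshev_le1 m u1; lra.
  rewrite [`|_ * x|]ger0_norm; last by rewrite mulr_ge0 ?divr_ge0.
  by rewrite -!mulrA ger_pMr // ler_pdivrMl // mulr1.
Qed.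

End FejerKernel.

(** * Upper bounds for mu *)

Section MuUpperLarge.
Variable R : realType.
Implicit Types (f : nat -> R) (Q : {poly R}).

Lemma sum_powR_le q n f : 1 <= q -> (forall j, 0 <= f j) ->
  \sum_(1 <= j < n.+1) f j `^ q <= (\sum_(1 <= j < n.+1) f j) `^ q.
Proof.
move=> q1 f0; set S := \sum_(1 <= j < _) f j.
have q0 : 0 < q by exact: lt_le_trans q1.
have S0 : 0 <= S by apply: sumr_ge0.
rewrite -mulr_powRB1 // mulr_suml !big_seq; apply: ler_sum => j jn.
rewrite -mulr_powRB1 // ler_wpM2l // ge0_ler_powR ?nnegrE ?subr_ge0 //.
by rewrite /S (bigD1_seq j) ?iota_uniq //= lerDl sumr_ge0.
Qed.

Lemma mu_le q n L Q : 1 <= q -> 0 < L -> Q.[0] = 1 ->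
  \sum_(1 <= j < n.+1) `|Q.[j%:R]| `^ q < L `^ q -> (mu q n L <= (size Q).-1)%N.
Proof.
move=> q1 L0 Q0 QL; apply: (muP n L (lt_le_trans ltr01 q1)).2.
exists (map_poly (real_complex R) Q); split.
  rewrite size_map_poly prednK // size_poly_gt0.
  by apply: contra_eq_neq Q0 => ->; rewrite horner0 eq_sym oner_eq0.
have QE j : cmod (map_poly (real_complex R) Q).[j%:R] = `|Q.[j%:R]|.
  by rewrite -(rmorph_nat (real_complex R)) horner_map cmod_real.
have -> : (fun j => cmod (map_poly (real_complex R) Q).[j%:R]) = (fun j => `|Q.[j%:R]|).
  by apply: funext => j; exact: QE.
have := QE 0%N; rewrite !mulr0n Q0 normr1 => ->.
rewrite div1r -ltr_pdivlMl ?invr_gt0 // invrK mulr1.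
exact: lqnorm_lt.
Qed.

(** Comparison with the telescoping sum of 1/((1 + B(j-1)) (1 + B j)). *)
Lemma sum_inv_sqr_le (B : R) n : 0 < B ->
  \sum_(1 <= j < n.+1) ((1 + B * j%:R) ^+ 2)^-1 <= B^-1.
Proof.
move=> B0; pose u j : R := - (B * (1 + B * j%:R))^-1.
rewrite big_add1 /=; apply: (@le_trans _ _ (\sum_(0 <= j < n) (u j.+1 - u j))).
  apply: ler_sum => j _.
  have a0 : 0 < 1 + B * j%:R by rewrite ltr_wpDr // mulr_ge0 // ltW.
  have -> : u j.+1 - u j = ((1 + B * j%:R) * (1 + B * j.+1%:R))^-1.
    rewrite /u -natr1; field; rewrite !gt_eqF //.
    by rewrite mulrDr mulr1 addrA ltr_wpDr ?(ltW B0).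
  have ab : 1 + B * j%:R <= 1 + B * j.+1%:R by rewrite lerD2l ler_pM2l ?ler_nat.
  have b0 := lt_le_trans a0 ab.
  by rewrite lef_pV2 ?posrE ?exprn_gt0 ?mulr_gt0 // expr2 ler_pM2r.
rewrite telescope_sumr // /u mulr0 addr0 mulr1 opprK addrC gerBl invr_ge0.
by rewrite mulr_ge0 ?addr_ge0 ?mulr_ge0 // ltW.
Qed.

(** From [|F(j)| <= min(1, 1/(B j))] one gets [|F(j)| <= 2/(1 + B j)], whose squares
    are summed by [sum_inv_sqr_le]. *)
Lemma peaked_square n (B : R) : (0 < n)%N -> 0 < B -> exists Q,
  [/\ Q.[0] = 1, (size Q).-1%:R <= 2 * Num.sqrt (n%:R * B),
      (forall j, (j <= n)%N -> `|Q.[j%:R]| <= 1) &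
      \sum_(1 <= j < n.+1) `|Q.[j%:R]| <= 4 / B].
Proof.
move=> n0 B0; have nR : 0 < n%:R :> R by rewrite ltr0n.
have nB0 : 0 <= n%:R * B by rewrite mulr_ge0 // ltW.
set y := Num.sqrt (n%:R * B); have y0 : 0 <= y by exact: sqrtr_ge0.
pose m := (Num.truncn y).+1.
have /andP[my ym] := truncn_itv y0.
have [F [F0 sF bF]] := @peaked_poly R m n isT n0.
exists (F ^+ 2); split.
- by rewrite horner_exp F0 expr1n.
- apply: le_trans (_ : (2 * Num.truncn y)%:R <= _); last by rewrite natrM ler_pM2l.
  by rewrite ler_nat size_exp mulnC leq_pmul2l //; move: sF; rewrite /m; case: (size F).
- move=> j jn; rewrite horner_exp normrX exprn_ile1 //.
  by have [|//] := bF j%:R; rewrite ler0n ler_nat.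
- have m2 : n%:R * B <= m%:R ^+ 2.
    by rewrite -(sqr_sqrtr nB0) ler_sqr ?nnegrE ?sqrtr_ge0 // ltW.
  apply: le_trans (_ : 4 * \sum_(1 <= j < n.+1) ((1 + B * j%:R) ^+ 2)^-1 <= _); last first.
    by rewrite ler_pM2l ?sum_inv_sqr_le.
  rewrite mulr_sumr !big_seq; apply: ler_sum => j.
  rewrite mem_index_iota ltnS => /andP[j0 jn].
  have jR : 0 < j%:R :> R by rewrite ltr0n.
  have [F1 F2] : `|F.[j%:R]| <= 1 /\ m%:R ^+ 2 * j%:R * `|F.[j%:R]| <= n%:R.
    by apply: bF; rewrite ler0n ler_nat.
  have Bj0 : 0 < 1 + B * j%:R by rewrite ltr_wpDr // mulr_ge0 // ltW.
  have FB : B * j%:R * `|F.[j%:R]| <= 1.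
    rewrite -(ler_pM2l nR) mulr1 (le_trans _ F2) // !mulrA.
    by rewrite ler_wpM2r // ler_wpM2r // ltW.
  have -> : 4 * ((1 + B * j%:R) ^+ 2)^-1 = (2 / (1 + B * j%:R)) ^+ 2.
    by field; rewrite gt_eqF.
  rewrite horner_exp normrX ler_sqr ?nnegrE ?divr_ge0 ?(ltW Bj0) //.
  by rewrite ler_pdivlMr // mulrDr mulr1 mulrC; lra.
Qed.

(** With B = 10/L^q the values are at most 1, so their q-th powers sum to at most
    4/B < L^q. *)
Lemma mu_upper_large (q L : R) (n : nat) : 1 <= q -> (0 < n)%N -> 0 < L ->
  (mu q n L)%:R <= Num.sqrt n%:R * (1 / 40 * L) `^ (- (q / 2)).
Proof.
move=> q1 n0 L0; rewrite sqrt_powRN; last by rewrite mulr_gt0 ?divr_gt0.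
have q0 : 0 < q by exact: lt_le_trans q1.
have X0 : 0 < L `^ q by exact: powR_gt0.
have [Q [Q0 sQ Q1 bQ]] := @peaked_square n (10 / L `^ q) n0 (divr_gt0 (ltr0n _ 10) X0).
apply: le_trans (_ : (size Q).-1%:R <= _).
  rewrite ler_nat; apply: mu_le => //.
  apply: le_lt_trans (_ : 4 / (10 / L `^ q) < _); last first.
    by rewrite invf_div; move: (L `^ q) X0 => X X0; lra.
  apply: le_trans bQ; rewrite !big_seq; apply: ler_sum => j.
  rewrite mem_index_iota => /andP[_ /Q1 j1].
  have [->|Qj] := eqVneq (`|Q.[j%:R]|) 0; first by rewrite powR0 // gt_eqF.
  by rewrite ge1r_powR // j1 lt_neqAle eq_sym Qj normr_ge0.
apply: (le_trans sQ).
have -> : 2 * Num.sqrt (n%:R * (10 / L `^ q)) = Num.sqrt (n%:R / (1 / 40 * L `^ q)).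
  have -> : n%:R / (1 / 40 * L `^ q) = 2 ^+ 2 * (n%:R * (10 / L `^ q)) by field; rewrite gt_eqF.
  by rewrite [RHS]sqrtrM ?sqr_ge0 // sqrtr_sqr ger0_norm.
rewrite ler_wsqrtr // ler_wpM2l // lef_pV2 ?posrE ?powR_gt0 ?mulr_gt0 ?divr_gt0 //.
rewrite powRM ?divr_ge0 ?(ltW L0) // ler_pM2r // ge1r_powR //.
by apply/andP; split; lra.
Qed.

End MuUpperLarge.

Section MuUpperSmall.
Variable R : realType.
Implicit Types (Q : {poly R}).

Definition root_poly h : {poly R} := \prod_(i < h) (1 - i.+1%:R^-1 *: 'X).

Lemma root_poly0 h : (root_poly h).[0] = 1.
Proof.
by rewrite horner_prod big1 // => i _; rewrite !hornerE /= subr0.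
Qed.

Lemma root_poly_eq0 h j : (0 < j <= h)%N -> (root_poly h).[j%:R] = 0.
Proof.
case: j => // j jh; rewrite horner_prod (bigD1 (Ordinal jh)) //= !hornerE /=.
by rewrite mulVf ?pnatr_eq0 // subrr mul0r.
Qed.

Lemma size_root_poly h : (size (root_poly h) <= h.+1)%N.
Proof.
elim: h => [|h IH]; first by rewrite /root_poly big_ord0 size_poly1.
rewrite /root_poly big_ord_recr /= -/(root_poly h).
have s2 : (size (1 - h.+1%:R^-1 *: 'X : {poly R})%R <= 2)%N.
  rewrite (leq_trans (size_polyD _ _)) // geq_max size_poly1 /= size_polyN.
  by rewrite (leq_trans (size_scale_leq _ _)) // size_polyX.
by rewrite (leq_trans (size_polyMleq _ _)) //; lia.
Qed.

Lemma prod_root_le h j : (h < j)%N ->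
  `|(root_poly h).[j%:R]| <= j%:R ^+ h / h`!%:R :> R.
Proof.
move=> hj; rewrite /root_poly horner_prod normr_prod.
have -> : j%:R ^+ h / h`!%:R = \prod_(i < h) (j%:R / i.+1%:R) :> R.
  rewrite prodf_div prodr_const card_ord; congr (_ / _).
  by rewrite -(prod_shift_fact 0) muln1 natr_prod.
apply: ler_prod => i _; rewrite normr_ge0 /= !hornerE.
have i0 : 0 < i.+1%:R :> R by rewrite ltr0n.
have ij : i.+1%:R <= j%:R :> R by rewrite ler_nat (leq_trans (ltn_ord i)) // ltnW.
rewrite distrC ger0_norm mulrC; first by rewrite gerBl.
by rewrite subr_ge0 ler_pdivlMr // mul1r.
Qed.

Lemma expR_le_inv m (x : R) : 0 <= 1 - x -> (1 - x) ^+ m * expR (m%:R * x) <= 1.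
Proof.
move=> x1; have := @pow_le_expR R m (- x) x1.
by rewrite mulrN expRN -ler_pdivlMr ?expR_gt0 // div1r.
Qed.

Lemma expR1_le : expR 1 <= 287 / 100 :> R.
Proof.
have := @expR_le_inv 10 (1 / 10); have -> : 10%:R * (1 / 10) = 1 :> R by field.
have := expR_ge0 (1 : R); move: (expR 1) => e e0 H.
have : (1 - 1 / 10) ^+ 10 * e <= 1 by apply: H; lra.
lra.
Qed.

(** By [h^h/h! <= e^h] and [e^3 <= 25]. *)
Lemma exp_ratio_le h : h%:R ^+ h / h`!%:R / 25 ^+ h <= expR (- (2 * h%:R)) :> R.
Proof.
have hh : h%:R ^+ h / h`!%:R <= expR h%:R :> R.
  case: h => [|h]; first by rewrite expr0 fact0 divr1 -[X in X <= _]expR0.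
  by apply: le_trans (expR_ge1Dxn h (ler0n R h.+1)); rewrite lerDr.
have e3 : expR (3 * h%:R) <= 25 ^+ h :> R.
  rewrite mulrC expRM_natl lerXn2r ?nnegrE ?expR_ge0 //.
  have -> : 3 = 3%:R * 1 :> R by rewrite mulr1.
  rewrite expRM_natl; apply: le_trans (_ : (287 / 100) ^+ 3 <= _); last by lra.
  have c0 : 0 <= 287 / 100 :> R by lra.
  by apply: lerXn2r expR1_le; rewrite nnegrE ?expR_ge0.
rewrite ler_pdivrMr ?exprn_gt0 // (le_trans hh) //.
apply: le_trans (_ : expR (- (2 * h%:R)) * expR (3 * h%:R) <= _).
  by rewrite -expRD; have -> : - (2 * h%:R) + 3 * h%:R = h%:R :> R by ring.
by rewrite ler_pM2l ?expR_gt0.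
Qed.

(** At an integer j > h the product of the roots is at most j^h/h!, and each factor F
    is at most h/(25 j).  Of the h + 2 factors F, the first h turn the bound into
    (h^h/h!)/25^h <= e^(-2h), and the last two make the sum over j converge. *)
Lemma peaked_with_roots n h : (0 < h)%N -> (0 < n)%N -> exists Q,
  [/\ Q.[0] = 1,
      (size Q).-1%:R <= h%:R + h.+2%:R * (5 * Num.sqrt (n%:R / h%:R)) :> R &
      \sum_(1 <= j < n.+1) `|Q.[j%:R]| <= 4 * (h%:R / 25) ^+ 2 * expR (- (2 * h%:R))].
Proof.
move=> h0 n0; have nR : 0 < n%:R :> R by rewrite ltr0n.
have hR : 0 < h%:R :> R by rewrite ltr0n.
set y : R := 5 * Num.sqrt (n%:R / h%:R).
have y0 : 0 <= y by rewrite mulr_ge0 ?sqrtr_ge0.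
pose m := (Num.truncn y).+1.
have /andP[my ym] := truncn_itv y0.
have [F [F0 sF bF]] := @peaked_poly R m n isT n0.
have m2 : 25 * n%:R / h%:R <= m%:R ^+ 2 :> R.
  have -> : 25 * n%:R / h%:R = y ^+ 2.
    rewrite /y exprMn sqr_sqrtr ?divr_ge0 //; ring.
  by rewrite ler_sqr ?nnegrE // ltW.
exists (root_poly h * F ^+ h.+2); split.
- by rewrite hornerM horner_exp F0 expr1n mulr1 root_poly0.
- apply: le_trans (_ : (h + h.+2 * Num.truncn y)%:R <= _).
    have sF' : ((size F).-1 <= Num.truncn y)%N by move: sF; rewrite /m; case: (size F).
    have sE : ((size (F ^+ h.+2)).-1 <= h.+2 * Num.truncn y)%N.
      by rewrite size_exp mulnC leq_mul2l sF' orbT.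
    have sQ := size_polyMleq (root_poly h) (F ^+ h.+2).
    rewrite ler_nat; move: sE sQ (size_root_poly h).
    by move: (_ * _)%N (size _) (size _) (size _) => a b c d; lia.
  by rewrite natrD natrM lerD2l ler_pM2l ?ltr0n.
have -> : 4 * (h%:R / 25) ^+ 2 * expR (- (2 * h%:R)) =
    4 * (h%:R / 25) ^+ 2 * expR (- (2 * h%:R)) * 1^-1 :> R by rewrite invr1 mulr1.
set C := 4 * _ * _.
have C0 : 0 <= C by rewrite !mulr_ge0 ?expR_ge0 ?sqr_ge0.
apply: le_trans (_ : C * \sum_(1 <= j < n.+1) ((1 + 1 * j%:R) ^+ 2)^-1 <= _); last first.
  by rewrite ler_wpM2l ?sum_inv_sqr_le.
rewrite mulr_sumr !big_seq; apply: ler_sum => j.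
rewrite mem_index_iota ltnS mul1r => /andP[j0 jn].
have jR : 1 <= j%:R :> R by rewrite ler1n.
have j'0 : 0 < 1 + j%:R :> R by lra.
have [jh|hj] := leqP j h.
  by rewrite hornerM root_poly_eq0 ?j0 // mul0r normr0 mulr_ge0 // invr_ge0 exprn_ge0 // ltW.
have [_ F2] : `|F.[j%:R]| <= 1 /\ m%:R ^+ 2 * j%:R * `|F.[j%:R]| <= n%:R.
  by apply: bF; rewrite ler0n ler_nat.
have Fj : `|F.[j%:R]| <= h%:R / (25 * j%:R).
  have : 25 * n%:R / h%:R * j%:R * `|F.[j%:R]| <= n%:R.
    by apply: le_trans F2; rewrite ler_wpM2r // ler_wpM2r.
  rewrite ler_pdivlMr; last by lra.
  have -> : 25 * n%:R / h%:R * j%:R * `|F.[j%:R]| = n%:R * (`|F.[j%:R]| * (25 * j%:R) / h%:R).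
    by ring.
  by rewrite ger_pMr // ler_pdivrMr // mul1r.
rewrite hornerM normrM horner_exp normrX.
apply: le_trans (_ : j%:R ^+ h / h`!%:R * (h%:R / (25 * j%:R)) ^+ h.+2 <= _).
  apply: ler_pM; rewrite ?exprn_ge0 ?prod_root_le //.
  by rewrite lerXn2r ?nnegrE ?divr_ge0 // mulr_ge0.
have -> : j%:R ^+ h / h`!%:R * (h%:R / (25 * j%:R)) ^+ h.+2 =
   (h%:R ^+ h / h`!%:R / 25 ^+ h) * (h%:R / (25 * j%:R)) ^+ 2 :> R.
  rewrite -[h.+2]addn2 exprD !expr_div_n !exprMn; field.
  by rewrite !expf_neq0 ?pnatr_eq0 -?lt0n ?fact_gt0 ?h0 ?j0.
apply: le_trans (_ : expR (- (2 * h%:R)) * (h%:R / (25 * j%:R)) ^+ 2 <= _).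
  by rewrite ler_wpM2r ?sqr_ge0 ?exp_ratio_le.
have -> : C * ((1 + j%:R) ^+ 2)^-1 =
    expR (- (2 * h%:R)) * (2 * (h%:R / 25) / (1 + j%:R)) ^+ 2.
  by rewrite /C; field; rewrite gt_eqF.
rewrite ler_pM2l ?expR_gt0 // ler_sqr ?nnegrE ?divr_ge0 ?mulr_ge0 ?(ltW j'0) //.
have -> : h%:R / (25 * j%:R) = (h%:R / 25) * j%:R^-1 :> R by field; rewrite gt_eqF //; lra.
have -> : 2 * (h%:R / 25) / (1 + j%:R) = (h%:R / 25) * (2 / (1 + j%:R)) :> R by ring.
rewrite ler_wpM2l ?divr_ge0 // ler_pdivlMr // ler_pdivrMl; lra.
Qed.

(** With l = - ln L: for l > n the root polynomial of degree n is enough, for l <= 2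
    the peaked square with B = 5/L, and in between h is the least integer
    above l, for which e^(-2h) leaves a factor e^(-h) to absorb the constants. *)
Lemma mu_upper_small (q L : R) (n : nat) : 1 <= q -> (0 < n)%N -> 0 < L -> L <= 1 / 2 ->
  (mu q n L)%:R <= 13 * Num.min (Num.sqrt (n%:R * - ln L)) n%:R.
Proof.
move=> q1 n0 L0 L2; set l := - ln L.
have nR : 0 < n%:R :> R by rewrite ltr0n.
have le : expR l = L^-1 by rewrite /l -lnV ?posrE // lnK ?posrE ?invr_gt0.
have l2 : 2 <= expR l by rewrite le -[2]invrK lef_pV2 ?posrE // -div1r.
have mu_le1 Q : Q.[0] = 1 -> \sum_(1 <= j < n.+1) `|Q.[j%:R]| < L ->
    (mu q n L)%:R <= (size Q).-1%:R :> R.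
  move=> Q0 QL; rewrite ler_nat; apply: mu_le => //.
  apply: le_lt_trans (sum_powR_le _ q1 _) _ => //.
  rewrite gt0_ltr_powR ?nnegrE ?sumr_ge0 ?(ltW L0) //.
  exact: lt_le_trans q1.
have mu_n : (mu q n L)%:R <= n%:R :> R.
  apply: le_trans (mu_le1 _ (root_poly0 n) _) _.
    by rewrite big_nat big1 // => j; rewrite ltnS => /root_poly_eq0->; rewrite normr0.
  by rewrite ler_nat; have := size_root_poly n; case: (size _).
have l0 : 1 / 2 < l.
  rewrite ltNge; apply/negP; rewrite -ler_expR => l12.
  have := @expR_le_inv 10 (1 / 20); have -> : 10%:R * (1 / 20) = 1 / 2 :> R by field.
  move=> /(_ ltac:(lra)); lra.
have nl0 : 0 <= n%:R * l by rewrite mulr_ge0 //; lra.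
rewrite -ler_pdivrMl // le_min !ler_pdivrMl //; apply/andP; split; last by lra.
have [nl|ln] := ltP n%:R l.
  apply: (le_trans mu_n); apply: le_trans (_ : Num.sqrt (n%:R * l) <= _).
    rewrite -[leLHS]ger0_norm // -sqrtr_sqr; apply: ler_wsqrtr.
    by rewrite expr2 ler_pM2l // ltW.
  by have := sqrtr_ge0 (n%:R * l); lra.
have [ll|ll] := leP l 2.
  have B0 : 0 < 5 / L by rewrite divr_gt0.
  have [Q [Q0 sQ _ bQ]] := @peaked_square R n _ n0 B0.
  apply: le_trans (mu_le1 _ Q0 _) _.
    by apply: (le_lt_trans bQ); rewrite invf_div; lra.
  apply: (le_trans sQ).
  have e1 := expR1_le.
  (* The degree bound 2 sqrt (5 n / L) against 13 sqrt (n l), squared. *)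
  have le169 : 20 * expR l <= 169 * l.
    have [l1|l1] := leP l 1.
      have : expR l <= expR 1 by rewrite ler_expR.
      lra.
    have : expR l <= expR 1 * expR 1 by rewrite -expRD ler_expR; lra.
    have := expR_ge0 (1 : R); nra.
  have -> : 2 * Num.sqrt (n%:R * (5 / L)) = Num.sqrt (n%:R * (20 * expR l)).
    have -> : n%:R * (20 * expR l) = 2 ^+ 2 * (n%:R * (5 / L)) by rewrite le; ring.
    by rewrite [RHS]sqrtrM ?sqr_ge0 // sqrtr_sqr ger0_norm.
  have -> : 13 * Num.sqrt (n%:R * l) = Num.sqrt (n%:R * (169 * l)).
    have -> : n%:R * (169 * l) = 13 ^+ 2 * (n%:R * l) by ring.
    by rewrite [RHS]sqrtrM ?sqr_ge0 // sqrtr_sqr ger0_norm.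
  by rewrite ler_wsqrtr // ler_pM2l.
have lge0 : 0 <= l by lra.
have /andP[tl lt] := truncn_itv lge0.
set h := (Num.truncn l).+1 in lt.
have hl1 : h%:R <= l + 1 by rewrite /h -natr1 lerD2r.
have hR : 0 < h%:R :> R by rewrite ltr0n.
have [Q [Q0 sQ bQ]] := @peaked_with_roots n h isT n0.
apply: le_trans (mu_le1 _ Q0 _) _.
  apply: (le_lt_trans bQ); rewrite -[L]invrK -le -expRN.
  have -> : - (2 * h%:R) = - h%:R + - h%:R :> R by ring.
  rewrite expRD mulrA; apply: le_lt_trans (_ : 1 * expR (- h%:R) < _); last first.
    by rewrite mul1r ltr_expR ltrN2.
  rewrite ler_pM2r ?expR_gt0 // expRN ler_pdivrMr ?expR_gt0 // mul1r.
  have := @expR_ge1Dxn R h%:R 1 (ltW hR); rewrite expr_div_n.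
  have -> : 2`!%:R = 2 :> R by [].
  have := sqr_ge0 (h%:R : R); move: (h%:R ^+ 2) (expR _) => a b; lra.
apply: (le_trans sQ).
(* The degree is h + 5 h v + 10 v, with h <= (3/2) w, h v <= (5/4) w, v <= w/2. *)
set v := Num.sqrt (n%:R / h%:R); set w := Num.sqrt (n%:R * l).
have v0 : 0 <= v by exact: sqrtr_ge0.
have w0 : 0 <= w by exact: sqrtr_ge0.
have v2 : v ^+ 2 = n%:R / h%:R by rewrite sqr_sqrtr // divr_ge0.
have w2 : w ^+ 2 = n%:R * l by rewrite sqr_sqrtr.
have lw : l <= w.
  by rewrite -ler_sqr ?nnegrE // w2 expr2 ler_wpM2r.
have vw : v <= 1 / 2 * w.
  rewrite -ler_sqr ?nnegrE // ?mulr_ge0 // exprMn v2 w2.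
  rewrite ler_pdivrMr //.
  have -> : (1 / 2) ^+ 2 * (n%:R * l) * h%:R = n%:R * (l * h%:R / 4) by field.
  by rewrite ler_peMr // ler_pdivlMr // mul1r; nra.
have hv : h%:R * v <= 5 / 4 * w.
  rewrite -ler_sqr ?nnegrE ?mulr_ge0 ?divr_ge0 // !exprMn v2 w2.
  have -> : h%:R ^+ 2 * (n%:R / h%:R) = n%:R * h%:R :> R by field; rewrite gt_eqF.
  rewrite mulrCA ler_pM2l //; lra.
have -> : h%:R + h.+2%:R * (5 * v) = h%:R + 5 * (h%:R * v) + 10 * v by rewrite -addn2 natrD; ring.
lra.
Qed.

End MuUpperSmall.

(** * Two-sided bounds for kappa and mu *)

Unset Implicit Arguments.

Theorem theorem2p1 (R : realType) :
  let bounds (c1 c2 c3 c4 : R) :=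
    forall (p : \bar R) (q : R),
      (1 < p)%E -> 1 <= q -> (p^-1 + (q%:E)^-1 = 1)%E ->
      (forall (n : nat) (L : R), (0 < n)%N -> 1 / 2 < L ->
         [/\ Num.sqrt n%:R * (c1 * L) `^ (- (q / 2)) - 1
               <= (kappa p n L)%:R,
             (kappa p n L <= mu q n L)%N
           & (mu q n L)%:R
               <= Num.sqrt n%:R * (c2 * L) `^ (- (q / 2)) + 2]) /\
      (forall (n : nat) (L : R), (0 < n)%N -> 0 < L -> L <= 1 / 2 ->
         [/\ c3 * Num.min (Num.sqrt (n%:R * - ln L)) n%:R
               <= (kappa p n L)%:R,
             (kappa p n L <= mu q n L)%N
           & (mu q n L)%:R
               <= c4 * Num.min (Num.sqrt (n%:R * - ln L)) n%:R + 4])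
  in
  (exists c1 c2 c3 c4 : R,
     [/\ 0 < c1, 0 < c2, 0 < c3 & 0 < c4] /\ bounds c1 c2 c3 c4) /\
  bounds 53 (1 / 40) (2 / 7) 13.
Proof.
move=> bounds; have B : bounds 53 (1 / 40) (2 / 7) 13.
  move=> p q p1 q1 pq; split=> [n L n0 L2|n L n0 L0 L2].
    have L0 : 0 < L by apply: lt_trans L2; rewrite divr_gt0.
    split; first exact: kappa_lower_large p1 q1 pq L2.
      exact: kappa_le_mu p1 q1 pq L0.
    by apply: le_trans (mu_upper_large q1 n0 L0) _; rewrite lerDl.
  split; first exact: kappa_lower_small p1 q1 pq n0 L0 L2.
    exact: kappa_le_mu p1 q1 pq L0.
  by apply: le_trans (mu_upper_small q1 n0 L0 L2) _; rewrite lerDl.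
by split=> //; exists 53, (1 / 40), (2 / 7), 13; split.
Qed.
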